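(* Let $S=k[X_1,\ldots,X_n]$ be a standard graded polynomial ring over a field $k$, let $I\subset S$ be a homogeneous ideal containing no linear forms, and let $R=S/I$. Suppose that the graded minimal free resolution of $R$ over $S$ admits a structure of an associative DG-algebra. Given $i\geq 2$, one has: (i) If $\mathrm{Tor}_{i+1}^R(k,k)_{\tau}=0$ for some integer $\tau$, then $$H_{i,\tau}\subseteq H_0\langle H_{i-j}H_j\mid 1\leq j\leq i-1\rangle_{\tau}.$$ In particular, this inclusion holds whenever $\tau>t_{i+1}^R(k)$ or $\tau<s_{i+1}^R(k)$. (ii) Suppose that the height of $I$ is at least $2$. If $t_{i+1}^R(k)<t_i^S(R)$, then $$t_i^S(R)\leq \max\{t_j^S(R)+t_{i-j}^S(R)\mid 1\leq j\leq i-1\}.$$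
   Context: For a graded $k$-algebra $A\in\{S,R\}$, a finitely generated graded $A$-module $N$ and $i\ge0$, $t_i^A(N):=\sup\{j\in\mathbb{Z}\mid \mathrm{Tor}_i^A(k,N)_j\neq 0\}$, and $s_{i}^R(k):=\inf\{j\mid \mathrm{Tor}_{i}^R(k,k)_j\neq 0\}$ is the initial degree of $\mathrm{Tor}_{i}^R(k,k)$. Let $x_1,\ldots,x_n$ be the images of $X_1,\ldots,X_n$ in $R$, let $K_\bullet=K_\bullet(x_1,\ldots,x_n;R)$ be the Koszul complex, and $H_i:=H_i(x_1,\ldots,x_n;R)$ its $i$th homology. $H_\bullet=\bigoplus_i H_i$ is an algebra with the product induced by that of $K_\bullet$; it is internally graded so that $H_{i,j}:=(H_i)_j\cong \mathrm{Tor}_i^S(k,R)_j$, and $H_0\cong k$. A product $H_aH_b$ denotes the span of the products of elements of $H_a$ and $H_b$. $H_0\langle H_{i-j}H_j\mid 1\leq j\leq i-1\rangle$ denotes the set of elements of $H_i$ generated (over $H_0$) by products of elements of homological degree strictly less than $i$, i.e. $\sum_{j=1}^{i-1}H_{i-j}H_j\subseteq H_i$, and the subscript $\tau$ denotes its component of internal degree $\tau$. *)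

(* Defs.v *)
From HB Require Import structures.
From mathcomp Require Import all_boot all_order all_algebra.
From mathcomp Require Export mpoly.
From mathcomp Require Export boolp classical_sets constructive_ereal.
Import Order.TTheory GRing.Theory Num.Theory.

Set Implicit Arguments.
Unset Strict Implicit.
Unset Printing Implicit Defensive.

Local Open Scope classical_set_scope.
Local Open Scope ring_scope.

(* Graded rings are presented as a commutative ring A with a family           *)
(* gr : int -> set A of graded pieces (zero in negative degrees).             *)

Definition mpoly_gr (k : fieldType) (n : nat) (j : int) : set {mpoly k[n]} :=
  match j with
  | Posz d => [set p | p \is d.-homog]
  | Negz _ => [set 0]
  end.

Definition quot_gr (k : fieldType) (n : nat) (I : idealr {mpoly k[n]})
    (j : int) : set {ideal_quot I} :=
  [set \pi_({ideal_quot I})%qT p | p in @mpoly_gr k n j].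

Definition homogeneous_ideal (k : fieldType) (n : nat)
    (I : idealr {mpoly k[n]}) : Prop :=
  forall (p : {mpoly k[n]}) (d : nat), p \in (I : pred _) ->
    pihomog mdeg d p \in (I : pred _).

Definition no_linear_forms (k : fieldType) (n : nat)
    (I : idealr {mpoly k[n]}) : Prop :=
  forall p : {mpoly k[n]}, p \in (I : pred _) -> p \is 1.-homog -> p = 0.

Definition irrelevant (A : comNzRingType) (gr : int -> set A) : set A :=
  [set a | exists2 s : seq A,
     forall b, b \in s -> exists2 j : int, 0 < j & gr j b &
     a = \sum_(b <- s) b].

(* F_i = A(-gf_deg i 0) (+) ... (+) A(-gf_deg i (gf_rank i - 1)), elements    *)
(* being row vectors on which gf_dif i : F_(i+1) -> F_i acts on the right.    *)
(* gf_aug represents, through its entries in A, a map from F_0 to a cyclic    *)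
(* module A/J.                                                                *)
Record gfree (A : comNzRingType) := GFree {
  gf_rank : nat -> nat;
  gf_deg : forall i, 'I_(gf_rank i) -> int;
  gf_dif : forall i, 'M[A]_(gf_rank i.+1, gf_rank i);
  gf_aug : 'cV[A]_(gf_rank 0)
}.

Definition gf_homog (A : comNzRingType) (gr : int -> set A) (F : gfree A)
    (i : nat) (j : int) : set 'rV[A]_(gf_rank F i) :=
  [set v | forall c, gr (j - gf_deg c) (v 0 c)].

Record is_resolution (A : comNzRingType) (gr : int -> set A) (J : set A)
    (F : gfree A) : Prop := IsResolution {
  res_dif_homog : forall i r c,
    gr (@gf_deg _ F i.+1 r - @gf_deg _ F i c) (gf_dif F i r c);
  res_aug_homog : forall r, gr (@gf_deg _ F 0%N r) (gf_aug F r 0);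
  res_exact : forall i (v : 'rV_(gf_rank F i.+1)),
    v *m gf_dif F i = 0 <-> exists w, v = w *m gf_dif F i.+1;
  res_exact0 : forall v : 'rV_(gf_rank F 0),
    J ((v *m gf_aug F) 0 0) <-> exists w, v = w *m gf_dif F 0;
  res_surj : forall a, exists v : 'rV_(gf_rank F 0),
    J (a - (v *m gf_aug F) 0 0)
}.

Definition is_minimal (A : comNzRingType) (gr : int -> set A) (F : gfree A) :
    Prop :=
  forall i r c, irrelevant gr (gf_dif F i r c).

(* Let k = A/A_+ and let F be a graded free resolution of a module N. Then    *)
(* Tor_i(k, N)_j is the quotient of gf_cycle F i j by gf_bound F i, these     *)
(* being the preimages in F_i of the degree j cycles and of the boundaries of *)
(* k (x) F = F / A_+ F.                                                       *)
Definition gf_cycle (A : comNzRingType) (gr : int -> set A) (F : gfree A)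
    (i : nat) (j : int) : set 'rV[A]_(gf_rank F i) :=
  match i return set 'rV[A]_(gf_rank F i) with
  | 0 => gf_homog gr j
  | i'.+1 => [set v | gf_homog gr j v /\
                      forall c, irrelevant gr ((v *m gf_dif F i') 0 c)]
  end.

Definition gf_bound (A : comNzRingType) (gr : int -> set A) (F : gfree A)
    (i : nat) : set 'rV[A]_(gf_rank F i) :=
  [set v | exists w, forall c, irrelevant gr ((v - w *m gf_dif F i) 0 c)].

Definition Tor_eq0 (A : comNzRingType) (gr : int -> set A) (F : gfree A)
    (i : nat) (j : int) : Prop :=
  gf_cycle gr j `<=` @gf_bound A gr F i.

Definition Tor_degrees (A : comNzRingType) (gr : int -> set A) (F : gfree A)
    (i : nat) : set (\bar int) :=
  [set j%:E | j in [set j : int | ~ Tor_eq0 gr F i j]].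

Definition Tor_sup (A : comNzRingType) (gr : int -> set A) (F : gfree A)
    (i : nat) : \bar int := supremum -oo%E (Tor_degrees gr F i).

Definition Tor_inf (A : comNzRingType) (gr : int -> set A) (F : gfree A)
    (i : nat) : \bar int := infimum +oo%E (Tor_degrees gr F i).

(* An associative DG-algebra structure on a resolution F of A/J.              *)
(* The product F_i x F_j -> F_l is indexed by a proof of i + j = l, so that   *)
(* no transport between F_(i + (j + p)) and F_((i + j) + p) is needed.        *)
(* Graded commutativity is not required.                                      *)
Record dg_algebra (A : comNzRingType) (gr : int -> set A) (J : set A)
    (F : gfree A) := DGAlgebra {
  dg_one : 'rV[A]_(gf_rank F 0);
  dg_mul : forall i j l : nat, (i + j)%N = l ->
    'rV[A]_(gf_rank F i) -> 'rV[A]_(gf_rank F j) -> 'rV[A]_(gf_rank F l);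
  dg_linl : forall i j l (e : (i + j)%N = l) a x y z,
    dg_mul e (a *: x + y) z = a *: dg_mul e x z + dg_mul e y z;
  dg_linr : forall i j l (e : (i + j)%N = l) a x y z,
    dg_mul e x (a *: y + z) = a *: dg_mul e x y + dg_mul e x z;
  dg_homog : forall i j l (e : (i + j)%N = l) (s t : int) x y,
    gf_homog gr s x -> gf_homog gr t y -> gf_homog gr (s + t) (dg_mul e x y);
  dg_assoc : forall i j p l m q (e1 : (i + j)%N = l) (e2 : (l + p)%N = q)
      (e3 : (j + p)%N = m) (e4 : (i + m)%N = q) x y z,
    dg_mul e2 (dg_mul e1 x y) z = dg_mul e4 x (dg_mul e3 y z);
  dg_one_homog : gf_homog gr 0 dg_one;
  dg_one_aug : J ((dg_one *m gf_aug F) 0 0 - 1);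
  dg_mul1l : forall i (e : (0 + i)%N = i) x, dg_mul e dg_one x = x;
  dg_mul1r : forall i (e : (i + 0)%N = i) x, dg_mul e x dg_one = x;
  (* the Leibniz rule, d being zero on F_0 *)
  dg_leibniz : forall i j l (e : (i.+1 + j.+1)%N = l.+1)
      (e1 : (i + j.+1)%N = l) (e2 : (i.+1 + j)%N = l) x y,
    dg_mul e x y *m gf_dif F l =
    dg_mul e1 (x *m gf_dif F i) y +
    (-1) ^+ i.+1 *: dg_mul e2 x (y *m gf_dif F j);
  dg_leibniz0l : forall j l (e : (0 + j.+1)%N = l.+1) (e2 : (0 + j)%N = l) x y,
    dg_mul e x y *m gf_dif F l = dg_mul e2 x (y *m gf_dif F j);
  dg_leibniz0r : forall i l (e : (i.+1 + 0)%N = l.+1) (e1 : (i + 0)%N = l) x y,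
    dg_mul e x y *m gf_dif F l = dg_mul e1 (x *m gf_dif F i) y
}.

(* z : {ffun {set 'I_n} -> A} stands for \sum_T z T e_T, where e_T is the     *)
(* exterior product of the e_t (t in T) in increasing order.                  *)
Section Koszul.

Variables (A : comNzRingType) (gr : int -> set A) (n : nat) (x : 'I_n -> A).

Local Notation K := {ffun {set 'I_n} -> A}.

Definition kz_dif (z : K) : K :=
  [ffun T : {set 'I_n} => \sum_(t | t \notin T)
     (-1) ^+ #|[set u in T | (u < t)%N]| * (x t * z (t |: T))].

(* e_U e_V = (-1) ^+ kz_inv U V e_(U :|: V) for disjoint U and V *)
Definition kz_inv (U V : {set 'I_n}) : nat :=
  #|[set p : 'I_n * 'I_n | [&& p.1 \in U, p.2 \in V & (p.2 < p.1)%N]]|.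

Definition kz_mul (y z : K) : K :=
  [ffun T : {set 'I_n} => \sum_(U : {set 'I_n} | U \subset T)
     (-1) ^+ kz_inv U (T :\: U) * (y U * z (T :\: U))].

Definition kz_cycle (i : nat) : set K :=
  [set z : K | (forall T : {set 'I_n}, #|T| != i -> z T = 0) /\ kz_dif z = 0].

(* e_T has internal degree #|T| *)
Definition kz_cycle_deg (i : nat) (j : int) : set K :=
  [set z : K | kz_cycle i z /\
           forall T : {set 'I_n}, #|T| = i -> gr (j - i%:Z) (z T)].

Definition kz_bound (z : K) : bool := `[< exists w, z = kz_dif w >].

Lemma kz_difB : zmod_morphism kz_dif.
Proof.
move=> y z; apply/ffunP => T; rewrite !ffunE -sumrB.
by apply: eq_bigr => t _; rewrite !ffunE !mulrBr.
Qed.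

Lemma kz_bound_zmod_closed : zmod_closed kz_bound.
Proof.
split=> [|y z /asboolP[v ->] /asboolP[w ->]]; apply/asboolP.
  by exists 0; have := kz_difB 0 0; rewrite !subrr.
by exists (v - w); rewrite kz_difB.
Qed.

HB.instance Definition _ :=
  GRing.isZmodClosed.Build K kz_bound kz_bound_zmod_closed.

Definition kz_boundC : zmodClosed K := GRing.ZmodClosed.clone K kz_bound _.

(* The homology of K is the image of the cycles in K modulo the boundaries.   *)
Definition kz_quot := {ideal_quot kz_boundC}.

Definition kz_H (i : nat) : set kz_quot :=
  [set \pi_(kz_quot)%qT z | z in kz_cycle i].

Definition kz_H_deg (i : nat) (j : int) : set kz_quot :=
  [set \pi_(kz_quot)%qT z | z in kz_cycle_deg i j].

(* On classes of cycles the result does not depend on the representatives.    *)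
Definition kz_H_mul (u v : kz_quot) : kz_quot :=
  \pi_(kz_quot)%qT (kz_mul (repr u) (repr v)).

Definition kz_H_decomp (i : nat) : set kz_quot :=
  [set h | exists2 s : seq (kz_quot * kz_quot),
     forall p, p \in s -> exists2 j : nat, (1 <= j <= i.-1)%N &
                          kz_H (i - j)%N p.1 /\ kz_H j p.2 &
     h = \sum_(p <- s) kz_H_mul p.1 p.2].

Definition kz_H_decomp_deg (i : nat) (j : int) : set kz_quot :=
  kz_H_decomp i `&` kz_H_deg i j.

End Koszul.

Definition prime_chain (A : comNzRingType) (P : prime_idealr A) (m : nat)
    (c : nat -> prime_idealr A) : Prop :=
  (forall l, (l < m)%N ->
     [set` (c l : pred A)] `<` [set` (c l.+1 : pred A)]) /\
  (c m : pred A) =i (P : pred A).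

Definition prime_height (A : comNzRingType) (P : prime_idealr A) : \bar int :=
  supremum -oo%E [set (m%:Z)%:E | m in [set m | exists c, prime_chain P m c]].

Definition height (A : comNzRingType) (I : idealr A) : \bar int :=
  infimum +oo%E [set prime_height P | P in
    [set P : prime_idealr A | {subset (I : pred A) <= (P : pred A)}]].

(* Main.v *)
(* Let F be the DG-algebra resolution, A = k (x) F, K the Koszul complex of S and
   B = K (x) F, a DG-algebra with surjective quasi-isomorphisms onto A and onto
   the Koszul complex of R; hence H is isomorphic to A.  Lift the differential
   of R (x) P to a differential on the F-module F (x) P (P being generated in
   degrees at most i), and the comparison map from the Koszul complex of R to P
   to an F-linear chain map from B to F (x) P.  Let lam be a linear form on A_i
   that vanishes on products of elements of positive degree.  On cycles of
   degree i of P, lam evaluated at the coefficient of P_0 in a lift to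
   F (x) P is well defined, because lam is a derivation, and R-linear, so that
   it kills R_+ Z_i(P).  The image of a Koszul cycle z of bidegree (i, tau) is a
   boundary, z having no unit coefficient since I contains no linear form, and
   it lies in R_+ Z_i(P) if Tor_(i+1)(k, k)_tau = 0.  Then lam vanishes on the
   class of A corresponding to z; lam being arbitrary, this class is a sum of
   products.  For the second part, if tau exceeds all the sums of a degree of a
   generator of F_j and one of F_(i-j), such products have no component in
   degree tau, so that F_i has no generator of degree tau. *)

Require Import Defs.
From HB Require Import structures.
From mathcomp Require Import all_boot all_order all_algebra.
From mathcomp Require Import mpoly zify.
From mathcomp Require Import boolp classical_sets constructive_ereal.
From mathcomp Require Import fintype finset.
Import Order.TTheory GRing.Theory Num.Theory.
Local Open Scope ring_scope.

Set Implicit Arguments.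
Unset Strict Implicit.
Unset Printing Implicit Defensive.

(** * Koszul complexes over a DG ring *)

(** The truncation of P at degree i is what makes the functional well defined. In the boundary of an
    element of total degree i + 1 of F (x) P, each basis element then has a coefficient of positive
    F-degree. Its contribution to P_0 is therefore either a product, which lam kills, or, for basis
    elements of degree 1, a multiple of the augmentation of a boundary of P, which lies in R_+. A
    basis element of degree i + 1 could carry a unit coefficient, and its differential could have
    any component in F_i (x) P_0; this is why P_(i+1) enters only through Tor. Homogeneity in F (x)
    P is recorded only after reduction to R, where Tor is tested. Since the product of F is not
    assumed commutative up to sign, coefficients stay on the left and only the images of the X_t,
    which are central, are moved past them. Elements of F_0 are replaced by scalars modulo
    boundaries, and boundaries have coefficients in the maximal ideal by minimality. *)

Lemma in_bset (T : Type) (b : pred T) p :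
  (p \in classical_sets.in_set [set q | b q]%classic) = b p.
Proof.
by apply/idP/idP => [/classical_sets.set_mem|bp]; last exact/classical_sets.mem_set.
Qed.

Section TwistedKoszul.

Variables (E : pzRingType) (n : nat) (x : 'I_n -> E).
Variables (s : {rmorphism E -> E}) (d : {additive E -> E}).
Hypothesis xC : forall t f, f * x t = x t * f.
Hypothesis sx : forall t, s (x t) = x t.
Hypothesis ss : involutive s.
Hypothesis dx : forall t, d (x t) = 0.
Hypothesis ds : forall f, d (s f) = - s (d f).
Hypothesis dM : forall f g, d (f * g) = d f * g + s f * d g.
Hypothesis dd : forall f, d (d f) = 0.

Local Notation K := {ffun {set 'I_n} -> E}.
Implicit Types (y z w : K) (T U : {set 'I_n}) (t r : 'I_n).

Definition kcnt t T := #|[set u in T | (u < t)%N]|.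

Lemma kcntU1 t r T : r \notin T -> kcnt t (r |: T) = ((r < t) + kcnt t T)%N.
Proof.
move=> rT; rewrite /kcnt.
have -> : [set u in r |: T | (u < t)%N] =
    (if (r < t)%N then [set r] else finset.set0) :|: [set u in T | (u < t)%N].
  apply/finset.setP => u; case: ifP => rt; rewrite !inE;
    by have [->|] := eqVneq u r; rewrite ?rt ?(negPf rT).
case: ifP => rt; last by rewrite finset.set0U.
by rewrite cardsU1 inE (negPf rT).
Qed.

Lemma kcnt_id t T : kcnt t (t |: T) = kcnt t T.
Proof.
have [tT|tT] := boolP (t \in T); last by rewrite kcntU1 // ltnn.
by congr kcnt; apply/finset.setUidPr; rewrite sub1set.
Qed.

Lemma kcntD1 t T : kcnt t (T :\ t) = kcnt t T.
Proof.
have [tT|tT] := boolP (t \in T); first by rewrite -kcnt_id setD1K.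
by congr kcnt; apply/setDidPl; rewrite disjoint_sym disjoints1.
Qed.

Lemma ksignM t T f : s ((-1) ^+ kcnt t T * f) = (-1) ^+ kcnt t T * s f.
Proof. by rewrite rmorphMsign. Qed.

Lemma signCA f m g : f * ((-1) ^+ m * g) = (-1) ^+ m * (f * g) :> E.
Proof. by rewrite !mulrA commr_sign. Qed.

(* y stands for \sum_T y_T e_T, with coefficients in E on the left; s is the
   sign involution of the DG ring (E, d). *)
Definition kd y : K := [ffun T : {set 'I_n} => d (y T) +
  \sum_(t | t \notin T) (-1) ^+ kcnt t T * (x t * s (y (t |: T)))].

Lemma kd_additive : zmod_morphism kd.
Proof.
move=> y z; apply/ffunP => T; rewrite !ffunE raddfB opprD addrACA -sumrB.
by congr (_ + _); apply: eq_bigr => t _; rewrite !ffunE raddfB !mulrBr.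
Qed.

HB.instance Definition _ := GRing.isZmodMorphism.Build K K kd kd_additive.

Definition kscale f y : K := [ffun T : {set 'I_n} => f * y T].

(** Left multiplication by e_t; moving e_t past a coefficient costs one [s]. *)
Definition keps t y : K :=
  [ffun T : {set 'I_n} => if t \in T then (-1) ^+ kcnt t T * s (y (T :\ t)) else 0].

Lemma keps_additive t : zmod_morphism (keps t).
Proof.
move=> y z; apply/ffunP => T; rewrite !ffunE; case: ifP => _; last by rewrite subrr.
by rewrite raddfB mulrBr.
Qed.

HB.instance Definition _ t :=
  GRing.isZmodMorphism.Build K K (keps t) (keps_additive t).

(** Exactly one of t < r and r < t holds, so exactly one of the counts changes by 1: this is the
    anticommutation of e_t with the contraction along e_r. *)
Lemma ksign_swap t r T : t \in T -> r \notin T ->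
  (-1) ^+ kcnt r T * (-1) ^+ kcnt t (r |: T) =
  - ((-1) ^+ kcnt t T * (-1) ^+ kcnt r (T :\ t)) :> E.
Proof.
move=> tT rT; have tr : t != r by apply: contraNneq rT => <-.
rewrite -{1}(setD1K tT) !kcntU1 ?setD11 // -!exprD.
have : (t < r)%N (+) (r < t)%N by case: ltngtP tr => // /val_inj->; rewrite eqxx.
have -> : ((t < r) + kcnt r (T :\ t) + ((r < t) + kcnt t T) =
   ((t < r) + (r < t)) + (kcnt t T + kcnt r (T :\ t)))%N.
  by rewrite addnACA; congr addn; rewrite addnC.
by rewrite exprD; case: (t < r)%N; case: (r < t)%N => //= _; rewrite expr1 mulN1r.
Qed.

(* With [koszul_ind], this relation yields [kd_kd] and [kd_kmul]. *)
Lemma kd_keps t y : kd (keps t y) = kscale (x t) y - keps t (kd y).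
Proof.
apply/(canRL (addrK _))/ffunP => T.
rewrite ![in LHS]ffunE; case: ifPn => tT.
  rewrite raddfMsign ds rmorphD mulrDr mulrN addrACA addNr add0r.
  rewrite [X in s X](bigD1 t) ?setD11 //= raddfD /= kcntD1 setD1K // mulrDr.
  rewrite ksignM rmorphM sx ss signrMK ffunE.
  rewrite addrCA -[RHS]addr0; congr (_ + _).
  have eT r : (r \notin T :\ t) && (r != t) = (r \notin T).
    by rewrite !inE; have [->|_] := eqVneq r t; rewrite ?tT ?andbT.
  rewrite raddf_sum mulr_sumr (eq_bigl _ _ eT).
  rewrite -big_split big1 //= => r rT; rewrite ffunE !inE tT orbT.
  have -> : (r |: T) :\ t = r |: T :\ t.
    apply/finset.setP => u; rewrite !inE; have [->|//] := eqVneq u r.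
    by rewrite (contraNneq _ rT) // => ->.
  rewrite !ksignM rmorphM sx !ss.
  by rewrite [x r * _]signCA !mulrA -!mulrDl ksign_swap // addNr !mul0r.
rewrite raddf0 add0r addr0 (bigD1 t) //= big1 => [|r /andP[rT rt]].
  rewrite addr0 ffunE setU11 kcnt_id setU1K // ksignM ss ffunE mulrA.
  by rewrite -mulrA signCA signrMK.
by rewrite ffunE !inE (negPf tT) orbF eq_sym (negPf rt) raddf0 !mulr0.
Qed.

Lemma kd_scale f y :
  kd (kscale f y) = kscale (d f) y + kscale (s f) (kd y).
Proof.
apply/ffunP => T; rewrite !ffunE dM mulrDr addrA; congr (_ + _).
rewrite mulr_sumr; apply: eq_bigr => t _.
by rewrite ffunE rmorphM signCA; congr (_ * _); rewrite !mulrA xC.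
Qed.

Lemma kd_scalex t y : kd (kscale (x t) y) = kscale (x t) (kd y).
Proof.
by rewrite kd_scale dx sx -[RHS]add0r; congr (_ + _); apply/ffunP => T;
  rewrite !ffunE mul0r.
Qed.

Definition kbase T f : K := [ffun U : {set 'I_n} => if U == T then f else 0].

Lemma kbase_sum y : y = \sum_T kbase T (y T).
Proof.
apply/ffunP => T; rewrite sum_ffunE (bigD1 T) //= ffunE eqxx big1 ?addr0 //.
by move=> U UT; rewrite ffunE eq_sym (negPf UT).
Qed.

Lemma kbase_eps t T f : t \in T ->
  kbase T f = keps t (kbase (T :\ t) ((-1) ^+ kcnt t T * s f)).
Proof.
move=> tT; apply/ffunP => U; rewrite !ffunE; have [tU|tU] := boolP (t \in U); last first.
  by case: eqP => // UT; rewrite UT tT in tU.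
have -> : (U :\ t == T :\ t) = (U == T).
  by apply/eqP/eqP => [UT|->//]; rewrite -(setD1K tU) UT setD1K.
by case: eqP => [->|_]; rewrite ?raddf0 ?mulr0 // ksignM ss signrMK.
Qed.

(** Each f e_T arises from a coefficient at e_set0 by successive multiplications with the e_t, t in
    T. Additive identities thus need checking only on scalars and through [keps]. *)
Lemma koszul_ind (P : K -> Prop) : (forall y z, P y -> P z -> P (y + z)) ->
  (forall f, P (kbase set0 f)) -> (forall t y, P y -> P (keps t y)) ->
  forall y, P y.
Proof.
move=> PD P0 Pe y; rewrite [y]kbase_sum; elim/big_ind: _ => // [|T _].
  have -> : 0 = kbase set0 0 by apply/ffunP => T; rewrite !ffunE if_same.
  exact: P0.
move: (y T) => f; have [m] := ubnP #|T|; elim: m => // m IHm in T f *.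
have [->|/set0Pn[t tT]] := eqVneq T set0; first by move=> _; apply: P0.
by rewrite ltnS (cardsD1 t) tT => Tm; rewrite (kbase_eps _ tT); apply/Pe/IHm.
Qed.

Lemma kd_base0 f : kd (kbase set0 f) = kbase set0 (d f).
Proof.
apply/ffunP => T; rewrite !ffunE big1 ?addr0 => [|t tT].
  by case: ifP; rewrite ?raddf0.
rewrite ffunE; case: eqP => [T0|]; last by rewrite raddf0 !mulr0.
by have := setU11 t T; rewrite T0 inE.
Qed.

Lemma kd_kd y : kd (kd y) = 0.
Proof.
elim/koszul_ind: y => [y z dy dz|f|t y dy]; first by rewrite !raddfD /= dy dz addr0.
  by rewrite !kd_base0 dd; apply/ffunP => T; rewrite !ffunE if_same.
by rewrite kd_keps raddfB /= kd_keps kd_scalex dy raddf0 subr0 subrr.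
Qed.

(** Moving the coefficient of z past e_U costs one [s] for each element of U. *)
Definition kmul y z : K := [ffun T : {set 'I_n} =>
  \sum_(U : {set 'I_n} | U \subset T)
    (-1) ^+ kz_inv U (T :\: U) * (y U * iter #|U| s (z (T :\: U)))].

Lemma kmulBl y w z : kmul (y - w) z = kmul y z - kmul w z.
Proof.
apply/ffunP => T; rewrite !ffunE -sumrB.
by apply: eq_bigr => U _; rewrite !ffunE mulrBl mulrBr.
Qed.

Lemma kmul0l z : kmul 0 z = 0.
Proof. by rewrite -[0 in LHS](subrr 0) kmulBl subrr. Qed.

Lemma kmulDl y w z : kmul (y + w) z = kmul y z + kmul w z.
Proof. by rewrite -[w in LHS]opprK kmulBl -sub0r kmulBl kmul0l sub0r opprK. Qed.

Lemma iter_raddf m : zmod_morphism (iter m s).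
Proof. by move=> f g; elim: m => //= m ->; rewrite raddfB. Qed.

HB.instance Definition _ m :=
  GRing.isZmodMorphism.Build E E (iter m s) (iter_raddf m).

Lemma kmul_additiver y : zmod_morphism (kmul y).
Proof.
move=> z w; apply/ffunP => T; rewrite !ffunE -sumrB.
by apply: eq_bigr => U _; rewrite !ffunE raddfB !mulrBr.
Qed.

HB.instance Definition _ y :=
  GRing.isZmodMorphism.Build K K (kmul y) (kmul_additiver y).

Lemma kmulDr y w z : kmul y (w + z) = kmul y w + kmul y z.
Proof. exact: raddfD. Qed.

Lemma kmul0r y : kmul y 0 = 0.
Proof. exact: raddf0. Qed.

Lemma kmul_scale f y z : kmul (kscale f y) z = kscale f (kmul y z).
Proof.
apply/ffunP => T; rewrite !ffunE mulr_sumr; apply: eq_bigr => U _.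
by rewrite ffunE signCA !mulrA.
Qed.

Lemma kmul_base0 f z : kmul (kbase set0 f) z = kscale f z.
Proof.
apply/ffunP => T; rewrite !ffunE (bigD1 set0) ?sub0set //= big1 => [|U /andP[_ U0]].
  rewrite ffunE eqxx cards0 setD0 addr0 /=.
  have -> : kz_inv set0 T = 0%N; last by rewrite mul1r.
  by rewrite /kz_inv eq_card0 // => p; rewrite in_bset inE.
by rewrite ffunE (negPf U0) mul0r mulr0.
Qed.

Lemma kcntE t T : kcnt t T = (\sum_(u in T) (u < t))%N.
Proof.
rewrite /kcnt -sum1_card big_mkcond [RHS]big_mkcond /=.
by apply: eq_bigr => u _; rewrite inE; case: (u \in T); case: (u < t)%N.
Qed.

Lemma kz_invE U T : kz_inv U T = (\sum_(u in U) kcnt u T)%N.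
Proof.
rewrite /kz_inv -sum1_card.
under [RHS]eq_bigr => u _ do rewrite kcntE big_mkcond.
rewrite pair_big /= big_mkcond [RHS]big_mkcond /=.
apply: eq_bigr => -[u v] _; rewrite in_bset /= andbT.
by do ![case: (_ \in _) => //=]; case: ltnP.
Qed.

(** Only the subsets of T containing t contribute; they are the t |: U with U inside T :\ t. If V is
    the complement of U there, t adds [kcnt t V] inversions, and [kcnt t T] is the sum of [kcnt t U]
    and [kcnt t V]. *)
Lemma kmul_eps t y z : kmul (keps t y) z = keps t (kmul y z).
Proof.
apply/ffunP => T; rewrite !ffunE (bigID (fun U : {set _} => t \in U)) /=.
rewrite [X in _ + X]big1 => [|U /andP[_ tU]]; last first.
  by rewrite ffunE (negPf tU) mul0r mulr0.
rewrite addr0; case: ifPn => tT; last first.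
  by rewrite big_pred0 // => U; apply: contraNF tT => /andP[/subsetP]; apply.
rewrite (reindex_onto (fun U => t |: U) (fun U => U :\ t)) /=; last first.
  by move=> U /andP[_ tU]; rewrite setD1K.
rewrite raddf_sum mulr_sumr; apply: eq_big => [U|U /andP[/andP[sUT _] /eqP eU]].
  rewrite setU11 andbT subUset sub1set tT /= subsetD1; congr (_ && _).
  by apply/eqP/idP => [eU|/setU1K //]; rewrite -eU setD11.
have tU : t \notin U by rewrite -eU setD11.
have -> : T :\: (t |: U) = (T :\ t) :\: U by rewrite setDDl.
set V := (T :\ t) :\: U.
have -> : kz_inv (t |: U) V = (kcnt t V + kz_inv U V)%N.
  by rewrite !kz_invE big_setU1.
have -> : kcnt t T = (kcnt t U + kcnt t V)%N.
  rewrite -kcntD1 !kcntE (big_setID U) /=; congr (_ + _)%N.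
  apply: eq_bigl => u; rewrite !inE; case: (boolP (u \in U)) => uU; rewrite ?andbF //.
  rewrite andbT (contraNneq _ tU) => [|<-//]; move/subsetP: sUT; apply.
  by rewrite !inE uU orbT.
rewrite ffunE setU11 cardsU1 tU /= kcnt_id setU1K // rmorphMsign rmorphM.
rewrite -mulrA !exprD -!mulrA add0n [RHS]signCA; congr (_ * _).
by rewrite [RHS]signCA.
Qed.

(** The sign of the total degree: [s] accounts for the degree of the coefficient, the power of -1
    for e_T. *)
Definition ktw y : K := [ffun T : {set 'I_n} => (-1) ^+ #|T| * s (y T)].

Lemma ktw_additive : zmod_morphism ktw.
Proof. by move=> y z; apply/ffunP => T; rewrite !ffunE raddfB mulrBr. Qed.

HB.instance Definition _ := GRing.isZmodMorphism.Build K K ktw ktw_additive.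

Lemma keps_ktw t y : keps t (ktw y) = - ktw (keps t y).
Proof.
apply/ffunP => T; rewrite !ffunE; case: ifP => tT; last by rewrite raddf0 mulr0 oppr0.
rewrite (cardsD1 t T) tT exprS !rmorphMsign ss mulN1r !mulNr opprK.
by rewrite signCA.
Qed.

Lemma kmulNl y z : kmul (- y) z = - kmul y z.
Proof. by rewrite -sub0r kmulBl kmul0l sub0r. Qed.

Theorem kd_kmul y z : kd (kmul y z) = kmul (kd y) z + kmul (ktw y) (kd z).
Proof.
elim/koszul_ind: y => [y w dy dw|f|t y dy].
- by rewrite kmulDl !raddfD /= dy dw !kmulDl /= addrACA.
- have -> : ktw (kbase set0 f) = kbase set0 (s f).
    apply/ffunP => T; rewrite !ffunE; case: eqP => [->|]; first by rewrite cards0 mul1r.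
    by rewrite raddf0 mulr0.
  by rewrite kd_base0 !kmul_base0 kd_scale.
rewrite kmul_eps kd_keps dy raddfD /= -!kmul_eps keps_ktw kmulNl kd_keps.
by rewrite kmulBl kmul_scale opprB addrA addrAC.
Qed.

End TwistedKoszul.
(** * The ring of a DG-algebra resolution *)

Section AtDegree.

Variables (A : comNzRingType) (rk : nat -> nat).

(** The family over all degrees that is v in degree q and 0 elsewhere; the transport along q = q' is
    confined to this definition. *)
Definition at_deg q (v : 'rV[A]_(rk q)) q' : 'rV[A]_(rk q') :=
  if @eqP _ q q' is ReflectT e then ecast q' 'rV[A]_(rk q') e v else 0.

Lemma at_degE q v : @at_deg q v q = v.
Proof. by rewrite /at_deg; case: eqP => // e; rewrite (eq_axiomK e). Qed.

Lemma at_deg_neq q v q' : q != q' -> @at_deg q v q' = 0.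
Proof. by rewrite /at_deg; case: eqP. Qed.

End AtDegree.

Section TotalAlgebra.

Variables (A : comNzRingType) (gr : int -> set A) (J : set A) (F : gfree A).
Variable G : dg_algebra gr J F.

(** The product is extended by 0 to all triples of degrees, so that products of families become
    plain double sums, free of proofs of i + j = l. *)
Definition dgM i j l (a : 'rV[A]_(gf_rank F i)) (b : 'rV[A]_(gf_rank F j)) :
    'rV[A]_(gf_rank F l) :=
  if @eqP _ (i + j)%N l is ReflectT e then dg_mul G e a b else 0.

Lemma dgME i j l (e : (i + j)%N = l) a b : dgM l a b = dg_mul G e a b.
Proof. by rewrite /dgM; case: eqP => // e'; rewrite (eq_irrelevance e' e). Qed.

Lemma dgM_neq i j l (a : 'rV_(gf_rank F i)) (b : 'rV_(gf_rank F j)) :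
  (i + j)%N != l -> dgM l a b = 0.
Proof. by rewrite /dgM; case: eqP. Qed.

Lemma dgM_linl i j l c (a a' : 'rV_(gf_rank F i)) (b : 'rV_(gf_rank F j)) :
  dgM l (c *: a + a') b = c *: dgM l a b + dgM l a' b.
Proof.
have [e|ne] := eqVneq (i + j)%N l; first by rewrite !(dgME e) dg_linl.
by rewrite !dgM_neq // scaler0 addr0.
Qed.

Lemma dgM_linr i j l c (a : 'rV_(gf_rank F i)) (b b' : 'rV_(gf_rank F j)) :
  dgM l a (c *: b + b') = c *: dgM l a b + dgM l a b'.
Proof.
have [e|ne] := eqVneq (i + j)%N l; first by rewrite !(dgME e) dg_linr.
by rewrite !dgM_neq // scaler0 addr0.
Qed.

Definition dgMr i j l (b : 'rV_(gf_rank F j)) (a : 'rV_(gf_rank F i)) := dgM l a b.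

HB.instance Definition _ i j l (a : 'rV_(gf_rank F i)) :=
  GRing.isLinear.Build A _ _ _ (@dgM i j l a) (fun c b b' => dgM_linr l c a b b').

HB.instance Definition _ i j l (b : 'rV_(gf_rank F j)) :=
  GRing.isLinear.Build A _ _ _ (@dgMr i j l b)
    (fun c a a' => @dgM_linl i j l c a a' b).

Lemma dgM_suml i j l (I : Type) (r : seq I) (P : pred I)
    (a : I -> 'rV_(gf_rank F i)) (b : 'rV_(gf_rank F j)) :
  dgM l (\sum_(u <- r | P u) a u) b = \sum_(u <- r | P u) dgM l (a u) b.
Proof. exact: (raddf_sum (@dgMr i j l b)). Qed.

Lemma dgMDl i j l (a a' : 'rV_(gf_rank F i)) (b : 'rV_(gf_rank F j)) :
  dgM l (a + a') b = dgM l a b + dgM l a' b.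
Proof. exact: (raddfD (@dgMr i j l b)). Qed.

Lemma dgM0l i j l (b : 'rV_(gf_rank F j)) : dgM l (0 : 'rV_(gf_rank F i)) b = 0.
Proof. exact: (raddf0 (@dgMr i j l b)). Qed.

Lemma dgMZl i j l c (a : 'rV_(gf_rank F i)) (b : 'rV_(gf_rank F j)) :
  dgM l (c *: a) b = c *: dgM l a b.
Proof. exact: (linearZ_LR (@dgMr i j l b)). Qed.

(** The sum over the intermediate degree m collapses to m = j + p on the left and m = i + j on the
    right, both below N because l is. *)
Lemma dgM_assoc i j p l N (a : 'rV_(gf_rank F i)) (b : 'rV_(gf_rank F j))
    (c : 'rV_(gf_rank F p)) : (l < N)%N ->
  \sum_(m < N) dgM l a (dgM m b c) = \sum_(m < N) dgM l (dgM m a b) c.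
Proof.
move=> lN; have [e|ne] := eqVneq (i + j + p)%N l; last first.
  rewrite !big1 // => m _.
    have [e|?] := eqVneq (i + j)%N m; last by rewrite (dgM_neq a b) // dgM0l.
    by rewrite dgM_neq // -e.
  have [e|?] := eqVneq (j + p)%N m; last by rewrite (dgM_neq b c) // linear0.
  by rewrite dgM_neq // -e addnA.
have jpN : (j + p < N)%N by rewrite (leq_ltn_trans _ lN) // -e -addnA leq_addl.
have ijN : (i + j < N)%N by rewrite (leq_ltn_trans _ lN) // -e leq_addr.
rewrite (bigD1 (Ordinal jpN)) //= [X in _ + X]big1 => [|m mjp]; last first.
  by rewrite (dgM_neq b c) ?linear0 // eq_sym; apply: contraNneq mjp => mE; apply/eqP/val_inj.
rewrite [RHS](bigD1 (Ordinal ijN)) //= [X in _ = _ + X]big1 => [|m mjp]; last first.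
  by rewrite (dgM_neq a b) ?dgM0l // eq_sym; apply: contraNneq mjp => mE; apply/eqP/val_inj.
rewrite !addr0 (dgME (erefl (j + p)%N)) (dgME (erefl (i + j)%N)).
by rewrite (dgME e) (dgME (etrans (addnA _ _ _) e)) (dg_assoc _ _ e _ (etrans (addnA _ _ _) e)).
Qed.

(* The direct product of the F_q as a ring; F itself is the subring of the
   elements of finite support. *)
Definition dgtot of dg_algebra gr J F := forall q, 'rV[A]_(gf_rank F q).
Local Notation E := (dgtot G).
Implicit Types f g h : E.

HB.instance Definition _ := gen_eqMixin E.
HB.instance Definition _ := gen_choiceMixin E.

Definition dg0 : E := fun q => 0.
Definition dgadd f g : E := fun q => f q + g q.
Definition dgopp f : E := fun q => - f q.

Lemma dgP f g : (forall q, f q = g q) -> f = g.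
Proof. by move=> fg; apply: functional_extensionality_dep. Qed.

Lemma dgaddA : associative dgadd.
Proof. by move=> f g h; apply: dgP => q; apply: addrA. Qed.
Lemma dgaddC : commutative dgadd.
Proof. by move=> f g; apply: dgP => q; apply: addrC. Qed.
Lemma dgadd0 : left_id dg0 dgadd.
Proof. by move=> f; apply: dgP => q; apply: add0r. Qed.
Lemma dgaddN : left_inverse dg0 dgopp dgadd.
Proof. by move=> f; apply: dgP => q; apply: addNr. Qed.

HB.instance Definition _ := GRing.isZmodule.Build E dgaddA dgaddC dgadd0 dgaddN.

Lemma dgE_D f g q : (f + g) q = f q + g q. Proof. by []. Qed.
Lemma dgE_N f q : (- f) q = - f q. Proof. by []. Qed.
Lemma dgE_0 q : (0 : E) q = 0. Proof. by []. Qed.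

Lemma dgE_sum (I : Type) (r : seq I) (P : pred I) (f : I -> E) q :
  (\sum_(i <- r | P i) f i) q = \sum_(i <- r | P i) f i q.
Proof. by elim/big_rec2: _ => // i y1 y2 _ <-. Qed.

Definition dgmul f g : E :=
  fun l => \sum_(i < l.+1) \sum_(j < l.+1) dgM l (f i) (g j).

(** Factors of degree above l do not contribute in degree l. Free bounds let sums coming from
    different target degrees share their ranges. *)
Lemma dgmulE N M f g l : (l < N)%N -> (l < M)%N ->
  dgmul f g l = \sum_(i < N) \sum_(j < M) dgM l (f i) (g j).
Proof.
move=> lN lM; rewrite /dgmul.
rewrite (big_ord_widen N (fun i => \sum_(j < l.+1) dgM l (f i) (g j)) lN).
rewrite big_mkcond /=.
apply: eq_bigr => i _; case: ltnP => [_|li].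
  rewrite (big_ord_widen M (fun j => dgM l (f i) (g j)) lM) big_mkcond /=.
  apply: eq_bigr => j _; case: ltnP => // lj.
  by rewrite dgM_neq // gtn_eqF // (leq_trans lj) ?leq_addl.
by rewrite big1 // => j _; rewrite dgM_neq // gtn_eqF // (leq_trans li) ?leq_addr.
Qed.

Definition dg1 : E := fun q => if q is 0 then dg_one G else 0.

Lemma dgmulA : associative dgmul.
Proof.
move=> f g h; apply: dgP => l.
have lM (m : 'I_l.+1) i : dgM l (f i) (dgmul g h m) =
    \sum_(j < l.+1) \sum_(p < l.+1) dgM l (f i) (dgM m (g j) (h p)).
  rewrite (@dgmulE l.+1 l.+1) // linear_sum; apply: eq_bigr => j _.
  exact: linear_sum.
have rM (m : 'I_l.+1) p : dgM l (dgmul f g m) (h p) =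
    \sum_(i < l.+1) \sum_(j < l.+1) dgM l (dgM m (f i) (g j)) (h p).
  rewrite (@dgmulE l.+1 l.+1) // dgM_suml; apply: eq_bigr => i _.
  exact: dgM_suml.
transitivity (\sum_(i < l.+1) \sum_(j < l.+1) \sum_(p < l.+1)
    \sum_(m < l.+1) dgM l (f i) (dgM m (g j) (h p))).
  apply: eq_bigr => i _; under eq_bigr do rewrite lM.
  by rewrite exchange_big; apply: eq_bigr => j _; rewrite exchange_big.
rewrite {2}/dgmul; under [RHS]eq_bigr => m _ do under eq_bigr do rewrite rM.
rewrite [RHS]exchange_big /=; under [RHS]eq_bigr do rewrite exchange_big.
rewrite [RHS]exchange_big; apply: eq_bigr => i _.
under [RHS]eq_bigr do rewrite exchange_big.
rewrite [RHS]exchange_big; apply: eq_bigr => j _; apply: eq_bigr => p _.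
exact: dgM_assoc.
Qed.

Lemma dgmul1l : left_id dg1 dgmul.
Proof.
move=> f; apply: dgP => l; rewrite /dgmul big_ord_recl /= [X in _ + X]big1 => [|i _].
  rewrite addr0 (bigD1 ord_max) //= big1 => [|j jl]; last first.
    by rewrite dgM_neq.
  by rewrite (dgME (add0n l)) dg_mul1l addr0.
by rewrite big1 // => j _; apply: dgM0l.
Qed.

Lemma dgmul1r : right_id dg1 dgmul.
Proof.
move=> f; apply: dgP => l; rewrite /dgmul exchange_big big_ord_recl /=.
rewrite [X in _ + X]big1 => [|i _]; last by rewrite big1 // => j _; apply: linear0.
rewrite addr0 (bigD1 ord_max) //= big1 => [|j jl]; last first.
  by rewrite dgM_neq // addn0.
by rewrite (dgME (addn0 l)) dg_mul1r addr0.
Qed.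

Lemma dgmulDl : left_distributive dgmul +%R.
Proof.
move=> f g h; apply: dgP => l; rewrite dgE_D -big_split; apply: eq_bigr => i _.
by rewrite -big_split; apply: eq_bigr => j _; apply: dgMDl.
Qed.

Lemma dgmulDr : right_distributive dgmul +%R.
Proof.
move=> f g h; apply: dgP => l; rewrite dgE_D -big_split; apply: eq_bigr => i _.
by rewrite -big_split; apply: eq_bigr => j _; apply: raddfD.
Qed.

HB.instance Definition _ :=
  GRing.Zmodule_isPzRing.Build E dgmulA dgmul1l dgmul1r dgmulDl dgmulDr.

Lemma dgE_M f g q : (f * g) q = \sum_(i < q.+1) \sum_(j < q.+1) dgM q (f i) (g j).
Proof. by []. Qed.

Lemma dgE_1 q : (1 : E) q = if q is 0 then dg_one G else 0. Proof. by case: q. Qed.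

Definition dgs f : E := fun q => (-1) ^+ q *: f q.

Lemma dgs_additive : zmod_morphism dgs.
Proof. by move=> f g; apply: dgP => q; apply: scalerBr. Qed.

HB.instance Definition _ := GRing.isZmodMorphism.Build E E dgs dgs_additive.

Lemma dgs_multiplicative : monoid_morphism dgs.
Proof.
split=> [|f g]; apply: dgP => q; rewrite /dgs.
  by rewrite dgE_1; case: q => [|q]; rewrite ?scale1r ?scaler0.
rewrite !dgE_M scaler_sumr; apply: eq_bigr => i _.
rewrite scaler_sumr; apply: eq_bigr => j _; rewrite dgMZl linearZ /= scalerA.
have [e|ne] := eqVneq (i + j)%N q; first by rewrite -exprD e.
by rewrite !dgM_neq // !scaler0.
Qed.

HB.instance Definition _ := GRing.isMonoidMorphism.Build E E dgs dgs_multiplicative.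

Lemma dgss : involutive dgs.
Proof. by move=> f; apply: dgP => q; rewrite /dgs scalerA -expr2 sqrr_sign scale1r. Qed.

Definition dgd f : E := fun q => f q.+1 *m gf_dif F q.

Lemma dgd_additive : zmod_morphism dgd.
Proof. by move=> f g; apply: dgP => q; apply: mulmxBl. Qed.

HB.instance Definition _ := GRing.isZmodMorphism.Build E E dgd dgd_additive.

Lemma dgds f : dgd (dgs f) = - dgs (dgd f).
Proof.
by apply: dgP => q; rewrite /dgd /dgs dgE_N -scalemxAl exprS mulN1r scaleNr.
Qed.

(** The three Leibniz rules in one formula, valid for all i and j: when i + j differs from q + 1
    every term is 0. *)
Lemma dgM_leibniz f g q i j : dgM q.+1 (f i) (g j) *m gf_dif F q =
  (if i is i'.+1 then dgM q (dgd f i') (g j) else 0) +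
  (if j is j'.+1 then dgM q (dgs f i) (dgd g j') else 0).
Proof.
have [e|ne] := eqVneq (i + j)%N q.+1; last first.
  rewrite dgM_neq // mul0mx; case: i j ne => [|i] [|j] ne; rewrite ?addr0 ?add0r //.
  - by rewrite dgM_neq // -(inj_eq succn_inj) -addnS.
  - by rewrite dgM_neq // -(inj_eq succn_inj) -addSn.
  rewrite !dgM_neq ?addr0 // -(inj_eq succn_inj) //; by rewrite -addnS.
rewrite (dgME e).
case: i j e => [|i] [|j] e //.
- have e1 : (0 + j = q)%N := succn_inj e.
  by rewrite (dg_leibniz0l _ e e1) add0r -(dgME e1) /dgs expr0 scale1r.
- have e1 : (i + 0 = q)%N by move: e; rewrite addSn => /succn_inj.
  by rewrite (dg_leibniz0r _ e e1) addr0 (dgME e1).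
have e1 : (i + j.+1 = q)%N by move: e; rewrite addSn => /succn_inj.
have e2 : (i.+1 + j = q)%N by rewrite addSnnS.
by rewrite (dg_leibniz _ e e1 e2) (dgME e1) dgMZl (dgME e2).
Qed.

Lemma dgdM f g : dgd (f * g) = dgd f * g + dgs f * dgd g.
Proof.
apply: dgP => q; rewrite dgE_D {1}/dgd dgE_M !mulmx_suml.
under eq_bigr => i _.
  rewrite mulmx_suml; under eq_bigr do rewrite dgM_leibniz.
  rewrite big_split /=.
over.
rewrite big_split /=; congr (_ + _).
  rewrite big_ord_recl big1 // add0r.
  by rewrite -[RHS]/(dgmul _ _ q) (@dgmulE q.+1 q.+2).
rewrite -[RHS]/(dgmul _ _ q) (@dgmulE q.+2 q.+1) //.
by apply: eq_bigr => i _; rewrite big_ord_recl add0r.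
Qed.

Definition dgc (a : A) : E := fun q => a *: (1 : E) q.

Lemma dgcl a f q : (dgc a * f) q = a *: f q.
Proof.
rewrite -[in RHS](mul1r f) !dgE_M scaler_sumr; apply: eq_bigr => i _.
by rewrite scaler_sumr; apply: eq_bigr => j _; rewrite dgMZl.
Qed.

Lemma dgcr a f q : (f * dgc a) q = a *: f q.
Proof.
rewrite -[in RHS](mulr1 f) !dgE_M scaler_sumr; apply: eq_bigr => i _.
by rewrite scaler_sumr; apply: eq_bigr => j _; rewrite linearZ.
Qed.

Lemma dgcC a f : f * dgc a = dgc a * f.
Proof. by apply: dgP => q; rewrite dgcr dgcl. Qed.

Lemma dgs_c a : dgs (dgc a) = dgc a.
Proof.
apply: dgP => -[|q]; rewrite /dgs /dgc; first by rewrite expr0 scale1r.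
by rewrite dgE_1 !scaler0.
Qed.

Lemma dgd_c a : dgd (dgc a) = 0.
Proof. by apply: dgP => q; rewrite /dgd /dgc dgE_1 scaler0 mul0mx. Qed.

Definition dghom q f := forall q', q' != q -> f q' = 0.

Lemma dghomD q f g : dghom q f -> dghom q g -> dghom q (f + g).
Proof. by move=> hf hg q' /[dup] /hf fq /hg gq; rewrite dgE_D fq gq addr0. Qed.

Lemma dghomN q f : dghom q f -> dghom q (- f).
Proof. by move=> hf q' /hf fq; rewrite dgE_N fq oppr0. Qed.

Lemma dghomB q f g : dghom q f -> dghom q g -> dghom q (f - g).
Proof. by move=> hf /dghomN; apply: dghomD. Qed.

Lemma dghomM p q f g : dghom p f -> dghom q g -> dghom (p + q) (f * g).
Proof.
move=> hf hg l lpq; rewrite dgE_M big1 // => i _; rewrite big1 // => j _.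
have [ip|/hf->] := eqVneq (i : nat) p; last exact: dgM0l.
have [jq|/hg->] := eqVneq (j : nat) q; last exact: linear0.
by rewrite dgM_neq // ip jq eq_sym.
Qed.

Lemma dghom_s q f : dghom q f -> dghom q (dgs f).
Proof. by move=> hf q' /hf; rewrite /dgs => ->; rewrite scaler0. Qed.

Lemma dghom_d q f : dghom q.+1 f -> dghom q (dgd f).
Proof. by move=> hf q' qq; rewrite /dgd hf ?mul0mx. Qed.

Lemma dghom_d0 f : dghom 0 f -> dgd f = 0.
Proof. by move=> hf; apply: dgP => q; rewrite /dgd hf ?mul0mx. Qed.

Lemma dghom_c a : dghom 0 (dgc a).
Proof. by case=> // q _; rewrite /dgc scaler0. Qed.

Lemma dghom_eq q f g : dghom q f -> dghom q g -> f q = g q -> f = g.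
Proof.
by move=> hf hg fg; apply: dgP => q'; have [->//|q'q] := eqVneq q' q; rewrite hf ?hg.
Qed.

Definition dgpart q f : E := fun q' => if q' == q then f q' else 0.

Lemma dghom_part q f : dghom q (dgpart q f).
Proof. by move=> q' /negPf q'q; rewrite /dgpart q'q. Qed.

Definition dgin q (v : 'rV[A]_(gf_rank F q)) : E := at_deg v.

Lemma dginE q v : @dgin q v q = v.
Proof. exact: at_degE. Qed.

Lemma dghom_in q v : dghom q (@dgin q v).
Proof. by move=> q' qq'; apply: at_deg_neq; rewrite eq_sym. Qed.

End TotalAlgebra.
(** * Graded pieces of polynomial rings and of their quotients *)

Section ZmodMorphism.

Variables (U V : zmodType) (f : U -> V) (fB : zmod_morphism f).

HB.instance Definition _ := GRing.isZmodMorphism.Build U V f fB.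

Lemma zmorph_sum (I : Type) (r : seq I) (P : pred I) (g : I -> U) :
  f (\sum_(i <- r | P i) g i) = \sum_(i <- r | P i) f (g i).
Proof. exact: raddf_sum. Qed.

Lemma zmorph0 : f 0 = 0. Proof. exact: raddf0. Qed.
Lemma zmorphN x : f (- x) = - f x. Proof. exact: raddfN. Qed.
Lemma zmorphD x y : f (x + y) = f x + f y. Proof. exact: raddfD. Qed.

End ZmodMorphism.

(** Common interface for S and R. Compatibility with multiplication by homogeneous elements is what
    lets projections pass through a homogeneous matrix. *)
Record graded_proj (A : comNzRingType) (gr : int -> set A) (pr : int -> A -> A) :
    Prop := GradedProj {
  gpr_additive : forall j, zmod_morphism (pr j);
  gpr_gr : forall j a, gr j (pr j a);
  gpr_id : forall j a, gr j a -> pr j a = a;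
  gpr_mul : forall i j a r, gr j r -> pr (i + j) (a * r) = pr i a * r
}.

Section GradedProj.

Variables (A : comNzRingType) (gr : int -> set A) (pr : int -> A -> A).
Hypothesis prP : graded_proj gr pr.

HB.instance Definition _ j :=
  GRing.isZmodMorphism.Build A A (pr j) (gpr_additive prP j).

Lemma pr_id j a : gr j a -> pr j a = a.
Proof. exact: (gpr_id prP). Qed.

Lemma id_pr j a : pr j a = a -> gr j a.
Proof. by move<-; apply: (gpr_gr prP). Qed.

Lemma gr0 j : gr j 0. Proof. by apply/id_pr; rewrite raddf0. Qed.

Lemma grD j a b : gr j a -> gr j b -> gr j (a + b).
Proof. by move=> /pr_id ga /pr_id gb; apply/id_pr; rewrite raddfD /= ga gb. Qed.

Lemma grN j a : gr j a -> gr j (- a).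
Proof. by move=> /pr_id ga; apply/id_pr; rewrite raddfN /= ga. Qed.

Lemma gr_sign j m a : gr j a -> gr j ((-1) ^+ m * a).
Proof.
by move=> ga; rewrite -signr_odd mulr_sign; case: ifP => // _; apply: grN.
Qed.

Lemma gr_sum j (I : Type) (r : seq I) (P : pred I) (f : I -> A) :
  (forall i, P i -> gr j (f i)) -> gr j (\sum_(i <- r | P i) f i).
Proof. by move=> gf; elim/big_ind: _ => //; [exact: gr0 | exact: grD]. Qed.

Lemma grM i j a b : gr i a -> gr j b -> gr (i + j) (a * b).
Proof. by move=> /pr_id ga gb; apply/id_pr; rewrite (gpr_mul prP) // ga. Qed.

Lemma pr_mulmx r s (dr : 'I_r -> int) (ds : 'I_s -> int) (M : 'M[A]_(r, s)) t
    (v : 'rV_r) : (forall a b, gr (dr a - ds b) (M a b)) ->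
  (\row_a pr (t - dr a) (v 0 a)) *m M = \row_b pr (t - ds b) ((v *m M) 0 b).
Proof.
move=> gM; apply/rowP => b; rewrite !mxE raddf_sum; apply: eq_bigr => a _.
by rewrite !mxE -(gpr_mul prP _ _ (gM a b)) addrA subrK.
Qed.

End GradedProj.

Section PolynomialRing.

Variables (k : fieldType) (n : nat).
Local Notation S := {mpoly k[n]}.
Implicit Types (p q : S) (m : 'X_{1..n}).

Lemma mpoly_maxP p : p@_0 = 0 ->
  exists g : 'I_n -> S, p = \sum_t 'X_t * g t.
Proof.
move=> p0; rewrite [p]mpolyE big_seq.
elim/big_ind: _ => [|q r [g ->] [h ->]|m mp].
- by exists (fun=> 0); rewrite big1 // => t _; rewrite mulr0.
- exists (fun t => g t + h t); rewrite -big_split.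
  by apply: eq_bigr => t _; rewrite mulrDr.
have : m != 0%MM by apply: contraTneq mp => ->; rewrite mcoeff_msupp p0 eqxx.
rewrite -mdeg_eq0 mdegE sum_nat_eq0 negb_forall => /existsP[t mt].
exists (fun u => if u == t then p@_m *: 'X_[m - U_(t)] else 0).
rewrite (bigD1 t) //= eqxx big1 => [|u /negPf->]; last by rewrite mulr0.
by rewrite addr0 -scalerAr mulrC -mpolyXD submK // lep1mP.
Qed.

Lemma mcoeffMXU t p m : ('X_t * p)@_m = if m t == 0%N then 0 else p@_(m - U_(t)).
Proof.
rewrite mulrC; case: eqVneq => mt; last by rewrite -{1}(@submK _ U_(t) m) ?lep1mP // addmC mcoeffMX.
rewrite [p]mpolyE mulr_suml raddf_sum big1 //= => m' _.
rewrite -scalerAl -mpolyXD mcoeffZ mcoeffX.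
case: eqP => [mE|_]; last by rewrite mulr0.
by move: mt; rewrite -mE mnmDE mnm1E eqxx addn1.
Qed.

(** Monomials without X_t are dropped, so [p - 'X_t * mpdiv t p] is p at X_t = 0. This supplies the
    contracting homotopy of the Koszul complex. *)
Definition mpdiv t p : S :=
  \sum_(m <- msupp p | m t != 0%N) p@_m *: 'X_[m - U_(t)].

Lemma mcoeff_mpdiv t p m : (mpdiv t p)@_m = p@_(m + U_(t)).
Proof.
rewrite /mpdiv raddf_sum /= big_mkcond /=.
transitivity (\sum_(m' <- msupp p | m' == (m + U_(t))%MM) p@_m').
  rewrite [RHS]big_mkcond; apply: eq_bigr => m' _.
  rewrite mcoeffZ mcoeffX; case: eqVneq => [m0|mt] /=.
    case: eqP m0 => // ->; by rewrite mnmDE mnm1E eqxx addn1.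
  have -> : ((m' - U_(t))%MM == m) = (m' == (m + U_(t))%MM).
    by apply/eqP/eqP => [<-|->]; rewrite ?submK ?lep1mP // addmK.
  by case: eqP; rewrite ?mulr1 ?mulr0.
have [mp|mp] := boolP ((m + U_(t))%MM \in msupp p).
  by rewrite (big_rem _ mp) /= eqxx big1_seq ?addr0 // => m' /andP[/eqP->];
    rewrite mem_rem_uniq ?msupp_uniq // inE eqxx.
rewrite memN_msupp_eq0 // big1_seq // => m' /andP[/eqP-> mp'].
by rewrite mp' in mp.
Qed.

Lemma mpdiv_additive t : zmod_morphism (mpdiv t).
Proof. by move=> p q; apply/mpolyP => m; rewrite mcoeffB !mcoeff_mpdiv mcoeffB. Qed.

HB.instance Definition _ t :=
  GRing.isZmodMorphism.Build S S (mpdiv t) (mpdiv_additive t).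

Lemma mpdivX t p : mpdiv t ('X_t * p) = p.
Proof.
apply/mpolyP => m; rewrite mcoeff_mpdiv mcoeffMXU mnmDE mnm1E eqxx addn1 /=.
by rewrite addmK.
Qed.

Lemma mpdivXn t u p : u != t -> mpdiv t ('X_u * p) = 'X_u * mpdiv t p.
Proof.
move=> ut; apply/mpolyP => m; rewrite mcoeff_mpdiv !mcoeffMXU mcoeff_mpdiv.
rewrite mnmDE mnm1E [t == u]eq_sym (negPf ut) addn0; case: eqVneq => // mu.
congr (_@__); apply/mnmP => v; rewrite !mnmDE !mnmBE mnmDE !mnm1E.
have [<-|] := eqVneq u v; last by rewrite !subn0.
by rewrite [t == u]eq_sym (negPf ut) !addn0.
Qed.

Lemma mcoeff_mpdivX t p m :
  (p - 'X_t * mpdiv t p)@_m = if m t == 0%N then p@_m else 0.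
Proof.
rewrite mcoeffB mcoeffMXU; case: eqVneq => mt; first by rewrite subr0.
by rewrite mcoeff_mpdiv submK ?lep1mP // subrr.
Qed.

Definition mpr (j : int) p : S := if j is Posz d then pihomog mdeg d p else 0.

Lemma mpr_proj : graded_proj (@mpoly_gr k n) mpr.
Proof.
split=> [[d|d] p q|[d|d] p|[d|d] p|i [e|e] p q].
- exact: pihomogB.
- by rewrite /= subrr.
- exact: pihomogP.
- by [].
- exact: pihomog_dE.
- by move=> ->.
- move=> qe; have mprB j : zmod_morphism (mpr j).
    by case: j => d u v; [exact: pihomogB | rewrite /= subrr].
  rewrite {1}[p]mpolyE mulr_suml (zmorph_sum (mprB _)) [in RHS](mpolyE p).
  rewrite (zmorph_sum (mprB _)) mulr_suml /=; apply: eq_bigr => m _.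
  have mqe : (p@_m *: 'X_[m] * q) \is (mdeg m + e).-homog.
    by rewrite -scalerAl; apply/rpredZ/dhomogM => //; rewrite dhomogX.
  have mh : p@_m *: 'X_[m] \is (mdeg m).-homog by rewrite rpredZ // dhomogX.
  have [im|im] := eqVneq i (mdeg m : int).
    by rewrite im /= (pihomog_dE mqe) (pihomog_dE mh).
  have -> : mpr i (p@_m *: 'X_[m]) = 0.
    by case: i im => //= d dm; rewrite (pihomog_ne0 _ mh) // eq_sym.
  rewrite mul0r; case ie : (i + e) => [d|//] /=.
  rewrite (pihomog_ne0 _ mqe) //; apply: contraNneq im => md.
  by apply/eqP/(addIr (e : int)); rewrite ie -md PoszD.
- by move=> ->; rewrite !mulr0; case: (i + _) => d //=; apply: raddf0.
Qed.

End PolynomialRing.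
Lemma irrelevant_sum (A : comNzRingType) (gr : int -> set A) (I : Type)
    (r : seq I) (P : pred I) (f : I -> A) :
  (forall i, P i -> irrelevant gr (f i)) ->
  irrelevant gr (\sum_(i <- r | P i) f i).
Proof.
move=> If; elim/big_ind: _ => // [|a b [s gs ->] [s' gs' ->]].
  by exists [::]; rewrite ?big_nil.
exists (s ++ s'); last by rewrite big_cat.
by move=> c; rewrite mem_cat => /orP[/gs|/gs'].
Qed.

Lemma gr_irrelevant (A : comNzRingType) (gr : int -> set A) (j : int) a :
  0 < j -> gr j a -> irrelevant gr a.
Proof.
move=> j0 ga; exists [:: a]; last by rewrite big_seq1.
by move=> b; rewrite inE => /eqP->; exists j.
Qed.

Section Quotient.

Variables (k : fieldType) (n : nat).
Local Notation S := {mpoly k[n]}.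

Lemma mcoeff_pihomog d (p : S) m :
  (pihomog mdeg d p)@_m = if mdeg m == d then p@_m else 0.
Proof.
case: ifPn => [md|md]; last exact: dhomog_nemf_coeff (pihomogP _ _ _) md.
rewrite pihomogE raddf_sum /=.
have [mp|mp] := boolP (m \in msupp p).
  rewrite big_mkcond (big_rem _ mp) /= md mcoeffZ mcoeffX eqxx mulr1.
  rewrite big1_seq ?addr0 // => m' /=; rewrite mem_rem_uniq ?msupp_uniq // inE.
  by move=> /andP[/negPf m'm _]; case: ifP => // _; rewrite mcoeffZ mcoeffX m'm mulr0.
rewrite memN_msupp_eq0 // big1_seq // => m' /andP[_ mp'].
rewrite mcoeffZ mcoeffX; case: eqP => [m'm|_]; last by rewrite mulr0.
by rewrite m'm (negPf mp) in mp'.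
Qed.

Lemma irrelevant_mpoly (p : S) : irrelevant (@mpoly_gr k n) p <-> p@_0 = 0.
Proof.
split=> [[s gs ->]|p0].
  rewrite raddf_sum big1_seq //= => q /gs[j j0 qj].
  case: j j0 qj => [[|d]|d] // _ qd.
  by rewrite (dhomog_nemf_coeff qd) //= mdeg0.
rewrite [p]mpolyE big_seq; apply: irrelevant_sum => m mp.
apply: (@gr_irrelevant _ _ (mdeg m : int)); last first.
  by rewrite /= rpredZ // dhomogX.
rewrite ltz_nat lt0n mdeg_eq0; apply: contraTneq mp => ->.
by rewrite mcoeff_msupp p0 eqxx.
Qed.

Variable I : idealr S.
Hypothesis I_homog : homogeneous_ideal I.
Local Notation R := {ideal_quot I}.
Local Notation "\pi p" := (\pi_R%qT p) (at level 10).

Lemma pi_eq0 (p : S) : (\pi p == 0 :> R) = (p \in (I : pred _)).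
Proof. by rewrite -(raddf0 (\pi_R)%qT) -Quotient.idealrBE subr0. Qed.

Lemma repr_pi (p : S) : exists2 q, q \in (I : pred _) & repr (\pi p : R) = p + q.
Proof.
exists (repr (\pi p : R) - p); last by rewrite addrC subrK.
by rewrite Quotient.idealrBE reprK.
Qed.

(** Otherwise the degree 0 component of p would be an invertible constant in the proper ideal I. *)
Lemma ideal_coef0 p : p \in (I : pred _) -> p@_0 = 0.
Proof.
move=> /(I_homog 0) pI; apply/eqP; apply: contraT => p0.
have pE : pihomog mdeg 0 p = p@_0 *: 1.
  apply/mpolyP => m; rewrite mcoeffZ mcoeff1 mcoeff_pihomog mdeg_eq0.
  by have [->|] := eqVneq m 0%MM; rewrite ?mulr1 ?mulr0.
have := idealr1 I; rewrite -[1](@scalerK _ _ (p@_0)) //.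
by rewrite -pE -mul_mpolyC idealMr.
Qed.

Definition quot_const (r : R) : k := (repr r)@_0.

Lemma quot_const_pi p : quot_const (\pi p) = p@_0.
Proof.
by rewrite /quot_const; have [q qI ->] := repr_pi p; rewrite mcoeffD (ideal_coef0 qI) addr0.
Qed.

Lemma quot_const_additive : zmod_morphism quot_const.
Proof.
move=> r s; rewrite -[r]reprK -[s]reprK -raddfB !quot_const_pi; exact: mcoeffB.
Qed.

HB.instance Definition _ := GRing.isZmodMorphism.Build R k quot_const quot_const_additive.

Lemma quot_const_monoid : monoid_morphism quot_const.
Proof.
split=> [|r s]; first by rewrite -(rmorph1 (\pi_R)%qT) quot_const_pi mcoeff1 eqxx.
by rewrite -[r]reprK -[s]reprK -rmorphM !quot_const_pi rmorphM.
Qed.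

HB.instance Definition _ := GRing.isMonoidMorphism.Build R k quot_const quot_const_monoid.

Lemma irrelevant_quot r : irrelevant (@quot_gr k n I) r <-> quot_const r = 0.
Proof.
split=> [[s gs ->]|r0].
  rewrite raddf_sum big1_seq //= => q /gs[j j0 [p pj <-]].
  case: j j0 pj => [[|d]|d] // _ pd.
  by rewrite quot_const_pi (dhomog_nemf_coeff pd) //= mdeg0.
have /irrelevant_mpoly[s gs rE] : (repr r)@_0 = 0 by [].
exists [seq (\pi p : R) | p <- s]; last first.
  by rewrite big_map -[LHS]reprK rE raddf_sum.
by move=> _ /mapP[p /gs[j j0 pj] ->]; exists j => //; exists p.
Qed.

Lemma quot_maxP (r : R) : quot_const r = 0 ->
  exists g : 'I_n -> R, r = \sum_t \pi 'X_t * g t.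
Proof.
move=> /mpoly_maxP[g rE]; exists (fun t => \pi (g t)).
by rewrite -[r]reprK rE raddf_sum; apply: eq_bigr => t _; apply: rmorphM.
Qed.

Definition qpr (j : int) (r : R) : R := \pi (mpr j (repr r)).

Lemma qpr_pi j p : qpr j (\pi p) = \pi (mpr j p).
Proof.
have [q qI qE] := repr_pi p; rewrite /qpr qE (zmorphD (gpr_additive (mpr_proj k n) j)).
apply/eqP; rewrite -Quotient.idealrBE addrC addrA addNr add0r.
by case: j => d /=; [exact: I_homog | exact: rpred0].
Qed.

Lemma qpr_proj : graded_proj (@quot_gr k n I) qpr.
Proof.
have mP := mpr_proj k n.
split=> [j r s|j r|j _ [p pj <-]|i j r _ [p pj <-]].
- by rewrite -[r]reprK -[s]reprK -raddfB !qpr_pi (gpr_additive mP) raddfB.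
- by exists (mpr j (repr r)); first exact: (gpr_gr mP).
- by rewrite qpr_pi (gpr_id mP).
by rewrite -{1}[r]reprK -rmorphM qpr_pi (gpr_mul mP _ _ pj) rmorphM.
Qed.

Lemma quot_const_gr j r : quot_gr j r -> j != 0 -> quot_const r = 0.
Proof.
move=> [[p pj <-]]; case: j pj => [d|d] /= pd d0; last by rewrite pd raddf0 raddf0.
by rewrite quot_const_pi (dhomog_nemf_coeff pd) //= mdeg0 eq_sym.
Qed.

Lemma quot_const_gr0 r : quot_const (qpr 0 r) = quot_const r.
Proof.
by rewrite -{2}[r]reprK !quot_const_pi /= mcoeff_pihomog mdeg0 eqxx.
Qed.

Hypothesis I_nolin : no_linear_forms I.

Definition quot_lin (t : 'I_n) (r : R) : k := (repr r)@_U_(t).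

(** Two representatives differ by an element of I, whose degree 1 component is a linear form in I,
    hence 0. *)
Lemma quot_lin_pi t p : quot_lin t (\pi p) = p@_U_(t).
Proof.
have [q qI qE] := repr_pi p; rewrite /quot_lin qE mcoeffD.
have /mpolyP/(_ U_(t)%MM) := I_nolin (I_homog 1 qI) (pihomogP _ _ _).
by rewrite mcoeff_pihomog mdeg1 eqxx mcoeff0 => ->; rewrite addr0.
Qed.

Lemma quot_lin_additive t : zmod_morphism (quot_lin t).
Proof.
move=> r s; rewrite -[r]reprK -[s]reprK -raddfB !quot_lin_pi; exact: mcoeffB.
Qed.

HB.instance Definition _ t := GRing.isZmodMorphism.Build R k (quot_lin t) (quot_lin_additive t).

Lemma quot_linX t u r : quot_lin t (\pi 'X_u * r) = (t == u)%:R * quot_const r.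
Proof.
rewrite -{1}[r]reprK -rmorphM quot_lin_pi mcoeffMXU mnm1E.
have [->|_] /= := eqVneq t u; last by rewrite mul0r.
by rewrite mul1r /quot_const; congr (_@__); apply/mnmP => i; rewrite mnmBE subnn mnm0E.
Qed.

(* A unit coefficient would produce a nonzero linear form in I. *)
Lemma kz_cycle_const0 i z T : (0 < i)%N ->
  kz_cycle (fun t => \pi 'X_t : R) i z -> quot_const (z T) = 0.
Proof.
move=> i0 [z0 dz]; have [Ti|/z0->] := eqVneq #|T| i; last exact: raddf0.
have /set0Pn[t tT] : T != set0 by rewrite -card_gt0 Ti.
have /ffunP/(_ (T :\ t)) := dz; rewrite !ffunE => /(congr1 (quot_lin t)).
rewrite raddf0 raddf_sum (bigD1 t) ?setD11 //= big1 => [|u /andP[_ ut]].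
  rewrite addr0 raddfMsign /= quot_linX eqxx mul1r setD1K // => /eqP.
  by rewrite mulf_eq0 signr_eq0 => /eqP.
by rewrite raddfMsign /= quot_linX eq_sym (negPf ut) mul0r mulr0.
Qed.

End Quotient.

(** * Semifree DG-modules *)

Section Resolution.

Variables (k : fieldType) (n : nat).
Local Notation S := {mpoly k[n]}.
Variable I : idealr S.
Hypothesis I_homog : homogeneous_ideal I.
Local Notation R := {ideal_quot I}.
Local Notation "\pi p" := (\pi_R%qT p) (at level 10).
Variable F : gfree S.
Local Notation JI := [set p : S | p \in (I : pred _)]%classic.
Hypothesis F_res : is_resolution (@mpoly_gr k n) JI F.
Hypothesis F_min : is_minimal (@mpoly_gr k n) F.
Variable G : dg_algebra (@mpoly_gr k n) JI F.
Local Notation E := (dgtot G).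
Implicit Types f g h : E.

Lemma dgdd f : dgd (dgd f) = 0.
Proof.
by apply: dgP => q; apply/(res_exact F_res (f q.+2 *m gf_dif F q.+1)); exists (f q.+2).
Qed.

Definition rho f : R := \pi ((f 0 *m gf_aug F) 0 0).

Lemma rho_additive : zmod_morphism rho.
Proof. by move=> f g; rewrite /rho dgE_D mulmxDl mulNmx !mxE raddfB. Qed.

HB.instance Definition _ := GRing.isZmodMorphism.Build E R rho rho_additive.

Lemma rho_d f : rho (dgd f) = 0.
Proof.
by apply/eqP; rewrite /rho pi_eq0; apply/(res_exact0 F_res); exists (f 1%N).
Qed.

Lemma rho_cM a f : rho (dgc G a * f) = \pi a * rho f.
Proof. by rewrite /rho dgcl -scalemxAl mxE rmorphM. Qed.

Lemma rho1 : rho 1 = 1.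
Proof.
rewrite /rho -[RHS](rmorph1 (\pi_R)%qT); apply/eqP; rewrite -Quotient.idealrBE.
exact: dg_one_aug G.
Qed.

Lemma rho_c a : rho (dgc G a) = \pi a.
Proof. by rewrite -[dgc G a]mulr1 rho_cM rho1 mulr1. Qed.

Lemma rho_hom q f : dghom q.+1 f -> rho f = 0.
Proof. by move=> hf; rewrite /rho hf // mul0mx mxE raddf0. Qed.

Lemma rho_s f : rho (dgs f) = rho f.
Proof. by rewrite /rho /dgs scale1r. Qed.

Lemma dg_exact q f : dghom q f -> dgd f = 0 -> rho f = 0 ->
  exists2 g, dghom q.+1 g & dgd g = f.
Proof.
case: q => [|q] hf df rf.
  have /(res_exact0 F_res)[w fw] : JI ((f 0 *m gf_aug F) 0 0).
    by rewrite /= -pi_eq0; apply/eqP.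
  exists (dgin G w); first exact: dghom_in.
  apply: dghom_eq hf _; first exact: dghom_d (dghom_in _ _).
  by rewrite /dgd dginE.
have /(res_exact F_res)[w fw] : f q.+1 *m gf_dif F q = 0 := congr1 (fun g => g q) df.
exists (dgin G w); first exact: dghom_in.
apply: dghom_eq hf _; first exact: dghom_d (dghom_in _ _).
by rewrite /dgd dginE.
Qed.

(** [dg_one] augments to 1 modulo I, so subtracting the scalar given by the augmentation leaves an
    element of F_0 that [rho] kills, which is a boundary by exactness. *)
Lemma dg0_decomp f : dghom 0 f ->
  exists2 g, dghom 1 g & f = dgc G ((f 0 *m gf_aug F) 0 0) + dgd g.
Proof.
set a := (f 0 *m _) 0 0 => hf.
have hfa : dghom 0 (f - dgc G a) := dghomB hf (@dghom_c _ _ _ _ _ _).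
have [|g hg gE] := dg_exact hfa (dghom_d0 hfa); last by exists g; rewrite // gE addrC subrK.
by rewrite raddfB /= rho_c subrr.
Qed.

Lemma dgM_0 f g : (f * g) 0 = dgM G 0 (f 0) (g 0).
Proof. by rewrite dgE_M !big_ord1. Qed.

(** Only components in F_0 matter. The left factor is a scalar plus some [dgd u], and [dgd u] times
    an element g of F_0 is again a boundary, g having zero differential. *)
Lemma rho_multiplicative : monoid_morphism rho.
Proof.
split=> [|f g]; first exact: rho1.
have rE h h' : h 0 = h' 0 -> rho h = rho h' by rewrite /rho => ->.
have hf : dghom 0 (dgpart 0 f : E) by exact: dghom_part.
have hg : dghom 0 (dgpart 0 g : E) by exact: dghom_part.
have p0 h : rho (dgpart 0 h : E) = rho h by [].
rewrite -(rE ((dgpart 0 f : E) * dgpart 0 g) (f * g)) ?dgM_0 // -(p0 f) -(p0 g).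
have [u hu fE] := dg0_decomp hf; set a := (_ *m _) 0 0 in fE.
rewrite fE mulrDl !raddfD /= rho_cM rho_c rho_d addr0.
have -> : dgd u * dgpart 0 g = dgd (u * dgpart 0 g).
  by rewrite dgdM (dghom_d0 hg) mulr0 addr0.
by rewrite rho_d addr0.
Qed.

HB.instance Definition _ := GRing.isMonoidMorphism.Build E R rho rho_multiplicative.

Definition dgmax f := forall q c, (f q 0 c)@_0 = 0.

Lemma dgmax0 : dgmax 0. Proof. by move=> q c; rewrite dgE_0 mxE mcoeff0. Qed.

Lemma dgmaxD f g : dgmax f -> dgmax g -> dgmax (f + g).
Proof. by move=> mf mg q c; rewrite dgE_D mxE mcoeffD mf mg addr0. Qed.

Lemma dgmaxN f : dgmax f -> dgmax (- f).
Proof. by move=> mf q c; rewrite dgE_N mxE mcoeffN mf oppr0. Qed.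

Lemma dgmaxB f g : dgmax f -> dgmax g -> dgmax (f - g).
Proof. by move=> mf /dgmaxN; apply: dgmaxD. Qed.

Lemma dgmax_sum (T : Type) (r : seq T) (P : pred T) (f : T -> E) :
  (forall i, P i -> dgmax (f i)) -> dgmax (\sum_(i <- r | P i) f i).
Proof. by move=> mf; elim/big_ind: _ => //; [exact: dgmax0 | exact: dgmaxD]. Qed.

Lemma dgmaxMl f g : dgmax f -> dgmax (f * g).
Proof.
move=> mf q c; rewrite dgE_M summxE raddf_sum big1 //= => i _.
rewrite summxE raddf_sum big1 //= => j _.
rewrite (row_sum_delta (f i)) dgM_suml summxE raddf_sum big1 //= => u _.
by rewrite dgMZl mxE rmorphM /= mf mul0r.
Qed.

Lemma dgmaxMr f g : dgmax g -> dgmax (f * g).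
Proof.
move=> mg q c; rewrite dgE_M summxE raddf_sum big1 //= => i _.
rewrite summxE raddf_sum big1 //= => j _.
rewrite (row_sum_delta (g j)) linear_sum summxE raddf_sum big1 //= => u _.
by rewrite linearZ mxE rmorphM /= mg mul0r.
Qed.

Lemma dgmax_d f : dgmax (dgd f).
Proof.
move=> q c; rewrite /dgd mxE raddf_sum big1 //= => j _.
have /irrelevant_mpoly d0 := F_min j c.
by rewrite rmorphM /= d0 mulr0.
Qed.

Lemma dgmax_c a : a@_0 = 0 -> dgmax (dgc G a).
Proof. by move=> a0; rewrite -[dgc G a]mulr1; move=> q c; rewrite dgcl mxE rmorphM /= a0 mul0r. Qed.

Section SemiFree.

Variables (T : finType) (deg : T -> nat).
Local Notation X := {ffun T -> E}.
Local Notation XR := {ffun T -> R}.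
Implicit Types (x y u : X) (v : XR).

Definition homX N x := forall j q, (q + deg j)%N != N -> x j q = 0.

Definition rhoX x : XR := [ffun j => rho (x j)].

Lemma rhoX_additive : zmod_morphism rhoX.
Proof. by move=> x y; apply/ffunP => j; rewrite !ffunE raddfB. Qed.

HB.instance Definition _ := GRing.isZmodMorphism.Build X XR rhoX rhoX_additive.

Lemma homXD N x y : homX N x -> homX N y -> homX N (x + y).
Proof. by move=> hx hy j q jq; rewrite ffunE dgE_D hx // hy // addr0. Qed.

Lemma homXN N x : homX N x -> homX N (- x).
Proof. by move=> hx j q jq; rewrite ffunE dgE_N hx // oppr0. Qed.

Lemma homXB N x y : homX N x -> homX N y -> homX N (x - y).
Proof. by move=> hx /homXN; apply: homXD. Qed.

Lemma homX_sum N (U : Type) (r : seq U) (P : pred U) (f : U -> X) :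
  (forall i, P i -> homX N (f i)) -> homX N (\sum_(i <- r | P i) f i).
Proof.
move=> hf; elim/big_ind: _ => //; last exact: homXD.
by move=> j q _; rewrite ffunE.
Qed.

Lemma homX_dghom N x j : homX N x -> (deg j <= N)%N -> dghom (N - deg j)%N (x j).
Proof.
by move=> hx jN q qN; rewrite hx //; apply: contraNneq qN => <-; rewrite addnK.
Qed.

Lemma homX_gt N x j : homX N x -> (N < deg j)%N -> x j = 0.
Proof.
move=> hx jN; apply: dgP => q; rewrite hx // gtn_eqF // (leq_trans jN) //.
exact: leq_addl.
Qed.

Variables (D : {additive X -> X}) (Dr : {additive XR -> XR}).

(* X is the free left E-module on T, the basis element j having degree deg j;
   Dr is the differential induced on R (x) X. *)
Record semifree : Prop := SemiFree {
  sf_DD : forall x, D (D x) = 0;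
  sf_hom : forall N x, homX N.+1 x -> homX N (D x);
  sf_tri : forall p x, (forall j, (p <= deg j)%N -> x j = 0) ->
             forall j, (p <= (deg j).+1)%N -> D x j = dgd (x j);
  sf_rho : forall x, rhoX (D x) = Dr (rhoX x)
}.

Hypothesis XP : semifree.

(* Kill the components of highest basis degree one after the other. *)
Lemma sf_ker_exact N x : homX N x -> D x = 0 -> rhoX x = 0 ->
  exists u, [/\ homX N.+1 u, D u = x & rhoX u = 0].
Proof.
have [p] : exists p, forall j, (p <= deg j)%N -> x j = 0.
  exists (\max_j deg j).+1 => j; rewrite ltnNge leq_bigmax //.
elim: p x => [|p IHp] x x0 hx Dx rx.
  have -> : x = 0 by apply/ffunP => j; rewrite ffunE x0.
  by exists 0; split; rewrite ?raddf0 // => j q _; rewrite ffunE.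
(* In the highest basis degree p, [D x] reads [dgd (x j)], so the coefficient x_j is a cycle and has
   a primitive g. As g has positive F-degree, [rho] kills it. *)
have ex j : exists g : E, [/\ deg j = p -> dgd g = x j, deg j != p -> g = 0,
    forall q, (q + deg j)%N != N.+1 -> g q = 0 & rho g = 0].
  have [jp|jp] := eqVneq (deg j) p; last first.
    by exists 0; split=> [/eqP|||]; rewrite ?(negPf jp) ?raddf0.
  have [jN|jN] := leqP (deg j) N; last first.
    by exists 0; split; rewrite ?raddf0 // (homX_gt hx).
  have dx : dgd (x j) = 0.
    by rewrite -(sf_tri XP x0) ?jp // Dx ffunE.
  have rj : rho (x j) = 0 by have /ffunP/(_ j) := rx; rewrite !ffunE.
  have [g hg dg] := dg_exact (homX_dghom hx jN) dx rj.
  exists g; split; [by [] | by move/eqP | | exact: rho_hom hg].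
  move=> q qN; apply: hg; apply: contraNneq qN => ->.
  by rewrite -subSn // subnK // leqW.
have [g gP] := choice ex; pose u : X := [ffun j => g j].
have hu : homX N.+1 u by move=> j q jq; rewrite ffunE; case: (gP j) => _ _ ->.
have ru : rhoX u = 0 by apply/ffunP => j; rewrite !ffunE; case: (gP j).
have u0 j : (p < deg j)%N -> u j = 0.
  by move=> jp; rewrite ffunE; case: (gP j) => _ -> //; rewrite gtn_eqF.
have [|||| w [hw Dw rw]] := IHp (x - D u).
- move=> j pj; rewrite !ffunE (sf_tri XP u0) // ffunE.
  have [jp|jp] := eqVneq (deg j) p; first by case: (gP j) => -> //; rewrite subrr.
  have {}pj : (p < deg j)%N by rewrite ltn_neqAle eq_sym jp.
  by rewrite x0 //; case: (gP j) => _ -> //; rewrite (raddf0 (@dgd _ _ _ _ G)) subr0.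
- exact: homXB hx (sf_hom XP hu).
- by rewrite raddfB /= Dx (sf_DD XP) subr0.
- by rewrite raddfB /= rx (sf_rho XP) ru raddf0 subr0.
exists (w + u); split; first exact: homXD.
  by rewrite raddfD /= Dw subrK.
by rewrite raddfD /= rw ru addr0.
Qed.

(** Lift v with scalar coefficients first; the defect x - D y is a cycle killed by [rhoX], hence the
    boundary of an element killed by [rhoX]. *)
Lemma sf_lift N x v : homX N x -> D x = 0 -> (forall j, deg j != N.+1 -> v j = 0) ->
  Dr v = rhoX x -> exists y, [/\ homX N.+1 y, D y = x & rhoX y = v].
Proof.
move=> hx Dx v0 vx.
pose y : X := [ffun j => if deg j == N.+1 then dgc G (repr (v j)) else 0].
have ry : rhoX y = v.
  apply/ffunP => j; rewrite !ffunE; case: ifPn => jN; first by rewrite rho_c reprK.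
  by rewrite raddf0 v0.
have hy : homX N.+1 y.
  move=> j q jq; rewrite ffunE; have [jN|//] := eqVneq (deg j) N.+1.
  by apply: (dghom_c _ (repr (v j))); apply: contraNneq jq => ->; rewrite jN.
have [||| u [hu Du ru]] := @sf_ker_exact N (x - D y).
- exact: homXB hx (sf_hom XP hy).
- by rewrite raddfB /= Dx (sf_DD XP) subrr.
- by rewrite raddfB /= (sf_rho XP) ry vx subrr.
exists (y + u); split; first exact: homXD.
  by rewrite raddfD /= Du addrC subrK.
by rewrite raddfD /= ru addr0.
Qed.

End SemiFree.

(** * The Koszul complex with coefficients in F *)

Definition kx (t : 'I_n) : E := dgc G 'X_t.
Definition qx (t : 'I_n) : R := \pi 'X_t.
Local Notation K := {ffun {set 'I_n} -> E}.
Local Notation KR := {ffun {set 'I_n} -> R}.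
Local Notation cardT := (fun T : {set 'I_n} => #|T|).

Definition dgD : K -> K := kd kx (@dgs _ _ _ _ G) (@dgd _ _ _ _ G).
Definition kosD : K -> K := kd kx (@dgs _ _ _ _ G) (\0 : E -> E).

HB.instance Definition _ := GRing.isZmodMorphism.Build K K dgD
  (kd_additive kx (@dgs _ _ _ _ G) (@dgd _ _ _ _ G)).
HB.instance Definition _ := GRing.isZmodMorphism.Build K K kosD
  (kd_additive kx (@dgs _ _ _ _ G) (\0 : E -> E)).
HB.instance Definition _ := GRing.isZmodMorphism.Build KR KR (kz_dif qx)
  (kz_difB qx).

Lemma kxC t f : f * kx t = kx t * f. Proof. exact: dgcC. Qed.

Lemma kx_s t : dgs (kx t) = kx t. Proof. exact: dgs_c. Qed.

Lemma dgDE (y : K) T : dgD y T = dgd (y T) + kosD y T.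
Proof. by rewrite !ffunE add0r. Qed.

Lemma kosDE (y : K) T : kosD y T =
  \sum_(t | t \notin T) (-1) ^+ kcnt t T * (kx t * dgs (y (t |: T))).
Proof. by rewrite ffunE add0r. Qed.

Lemma dgDD y : dgD (dgD y) = 0.
Proof.
apply: kd_kd; [exact: kxC | exact: kx_s | exact: dgss | | exact: dgds
  | exact: dgdM | exact: dgdd].
by move=> t; apply: dgd_c.
Qed.

Lemma kosDD y : kosD (kosD y) = 0.
Proof.
apply: kd_kd; [exact: kxC | exact: kx_s | exact: dgss | by [] | | | by []].
  by move=> f; rewrite /= raddf0 oppr0.
by move=> f g; rewrite /= mul0r mulr0 addr0.
Qed.

Lemma dgE_sign m f q : (((-1) ^+ m : E) * f) q = (-1) ^+ m *: f q.
Proof.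
rewrite -signr_odd mulr_sign -[in RHS]signr_odd.
by case: (odd m); rewrite /= ?expr1 ?expr0 ?scaleN1r ?scale1r.
Qed.

Lemma dgE_kterm m t f q : (((-1) ^+ m : E) * (kx t * dgs f)) q =
  (-1) ^+ m *: ('X_t *: ((-1) ^+ q *: f q)).
Proof. by rewrite dgE_sign dgcl. Qed.

Lemma kosD_comp (y : K) T q : kosD y T q =
  \sum_(t | t \notin T)
     (-1) ^+ kcnt t T *: ('X_t *: ((-1) ^+ q *: y (t |: T) q)).
Proof. by rewrite kosDE dgE_sum; apply: eq_bigr => t _; apply: dgE_kterm. Qed.

Lemma kosD_hom N (y : K) : homX cardT N.+1 y -> homX cardT N (kosD y).
Proof.
move=> hy T q qT; rewrite kosD_comp big1 // => t tT.
by rewrite hy ?scaler0 // cardsU1 tT addnA addn1 addSn.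
Qed.

Lemma dgD_semifree : semifree cardT dgD (kz_dif qx).
Proof.
split=> [|N y hy T q qT|p y y0 T pT|y].
- exact: dgDD.
- by rewrite dgDE dgE_D /dgd hy ?addSn // mul0mx add0r (kosD_hom hy).
- rewrite dgDE kosDE big1 ?addr0 // => t tT.
  by rewrite y0 ?raddf0 ?mulr0 // cardsU1 tT.
apply/ffunP => T; rewrite !ffunE raddfD /= rho_d add0r raddf_sum.
apply: eq_bigr => t _. rewrite raddfMsign /= rmorphM ffunE /= rho_s rho_c.
(* [kz_dif] counts its sign in a classical set, [kcnt] in a finite set with the same elements. *)
by congr ((-1) ^+ _ * _); apply: eq_card => u; rewrite in_bset inE.
Qed.

Definition dgdiv t f : E := fun q => map_mx (mpdiv t) (f q).

Lemma dgdiv_additive t : zmod_morphism (dgdiv t).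
Proof. by move=> f g; apply: dgP => q; apply: map_mxB. Qed.

HB.instance Definition _ t :=
  GRing.isZmodMorphism.Build E E (dgdiv t) (dgdiv_additive t).

Lemma dgdiv_s t f : dgdiv t (dgs f) = dgs (dgdiv t f).
Proof.
apply: dgP => q; rewrite /dgdiv /dgs; apply/matrixP => i j; rewrite !mxE.
by rewrite raddfMsign.
Qed.

Lemma dgdiv_sign t m f : dgdiv t ((-1) ^+ m * f) = (-1) ^+ m * dgdiv t f.
Proof.
apply: dgP => q; rewrite /dgdiv !dgE_sign; apply/matrixP => i j; rewrite !mxE.
by rewrite raddfMsign.
Qed.

Lemma dgdivX t f : dgdiv t (kx t * f) = f.
Proof.
by apply: dgP => q; apply/matrixP => i j; rewrite mxE dgcl mxE mpdivX.
Qed.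

Lemma dgdivXn t u f : u != t -> dgdiv t (kx u * f) = kx u * dgdiv t f.
Proof.
move=> ut; apply: dgP => q; apply/matrixP => i j.
by rewrite mxE !dgcl !mxE mpdivXn.
Qed.

Definition kosH t (y : K) : K :=
  keps (@dgs _ _ _ _ G) t [ffun T => dgdiv t (y T)].

Lemma kosH_comp t (y : K) T q : kosH t y T q = if t \in T then
  (-1) ^+ kcnt t T *: ((-1) ^+ q *: dgdiv t (y (T :\ t)) q) else 0.
Proof. by rewrite ffunE; case: ifP => // _; rewrite dgE_sign ffunE. Qed.

(** Put w = y / X_t. Then kosD (e_t w) = X_t w - e_t kosD w, and division by X_t commutes with every
    term of kosD except the one of index t. Dividing kosD y = 0 by X_t evaluates kosD w. As a
    result, y - kosD (kosH t y) involves neither e_t nor X_t. *)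
Lemma kosDH t y T : kosD y = 0 ->
  kosD (kosH t y) T = if t \in T then y T else kx t * dgdiv t (y T).
Proof.
move=> dy; rewrite /kosD /kosH (kd_keps kx_s (@dgss _ _ _ _ G)); last first.
  by move=> f; rewrite /= raddf0 oppr0.
rewrite -/(kosD _); set w := [ffun T => dgdiv t (y T)].
rewrite [LHS]ffunE [X in _ + X]ffunE [X in X - _]ffunE [X in _ - X]ffunE.
rewrite [w T]ffunE; case: ifPn => tT; last by rewrite subr0.
have e0 : (-1) ^+ kcnt t (T :\ t) * dgs (y T) +
    \sum_(r | (r \notin T :\ t) && (r != t)) (-1) ^+ kcnt r (T :\ t) *
      (kx r * dgs (dgdiv t (y (r |: T :\ t)))) = 0.
  transitivity (dgdiv t (kosD y (T :\ t))); last first.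
    by rewrite dy ffunE (zmorph0 (dgdiv_additive t)).
  rewrite kosDE.
  rewrite (zmorph_sum (dgdiv_additive t)).
  rewrite [RHS](bigD1 t) ?setD11 //.
  rewrite setD1K //.
  rewrite [X in _ = X + _]dgdiv_sign [dgdiv t (kx t * _)]dgdivX.
  congr (_ + _); apply: eq_bigr => r /andP[_ rt].
  by rewrite [RHS]dgdiv_sign [in RHS]dgdivXn // dgdiv_s.
have -> : kosD w (T :\ t) = (-1) ^+ kcnt t (T :\ t) *
    (kx t * dgs (dgdiv t (y T)) - dgs (y T)).
  rewrite kosDE (bigD1 t) ?setD11 //= setD1K // mulrBr ffunE; congr (_ + _).
  rewrite (addr0_eq e0).
  by apply: eq_bigr => r _; rewrite ffunE.
rewrite ksignM kcntD1 signrMK raddfB /= rmorphM /= !dgss kx_s.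
by rewrite opprB addrC subrK.
Qed.

Lemma homX_kosH t N y : homX cardT N y -> homX cardT N.+1 (kosH t y).
Proof.
move=> hy T q qT; rewrite kosH_comp; case: ifP => // tT.
rewrite /dgdiv hy ?map_mx0 ?scaler0 //; last first.
  by apply: contraNneq qT; rewrite (cardsD1 t T) tT addnS => ->.
Qed.

(* Contract onto the constant terms one variable at a time. *)
Lemma kosD_exact y : kosD y = 0 -> dgmax (y set0) ->
  exists u, [/\ kosD u = y, u set0 = 0,
    forall N, homX cardT N y -> homX cardT N.+1 u &
    forall q, (forall T, y T q = 0) -> forall T, u T q = 0].
Proof.
(* Once the variables of r are treated, the remainder consists of the coefficients of y whose index
   set and monomial avoid r. In the end only the constant terms at [set0] could remain, and [my]
   kills them. *)
move=> dy my; pose free (r : seq 'I_n) (T : {set 'I_n}) (m : 'X_{1..n}) :=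
  all (fun t => (t \notin T) && (m t == 0%N)) r.
have [u [uE u0 uh uq]] : exists u : K, [/\ forall T q c m, ((y - kosD u) T q 0 c)@_m =
      if free (enum 'I_n) T m then (y T q 0 c)@_m else 0, u set0 = 0,
    forall N, homX cardT N y -> homX cardT N.+1 u &
    forall q, (forall T, y T q = 0) -> forall T, u T q = 0].
  elim: (enum _) => [|t r [u [uE u0 uh uq]]].
    exists 0; split=> [T q c m||N _ T q _|q _ T]; first by rewrite raddf0 subr0.
    - by rewrite ffunE.
    - by rewrite ffunE.
    by rewrite ffunE.
  set z := y - kosD u in uE; have dz : kosD z = 0 by rewrite raddfB /= dy kosDD subr0.
  exists (u + kosH t z); split=> [T q c m||N hy|q y0 T].
  - rewrite raddfD /= opprD addrA -/z ffunE [X in z T + X]ffunE kosDH //.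
    rewrite /free /= -/(free r T m); have [tT|tT] /= := boolP (t \in T).
      by rewrite subrr mxE mcoeff0.
    rewrite dgE_D dgE_N dgcl !mxE mcoeff_mpdivX uE.
    by case: eqP.
  - by rewrite ffunE u0 ffunE inE addr0.
  - apply: homXD; first exact: uh.
    by apply: homX_kosH; apply: homXB hy (kosD_hom (uh _ hy)).
  have z0 U : z U q = 0.
    rewrite /z ffunE dgE_D y0 add0r [(- _ : K) U]ffunE dgE_N kosD_comp big1 ?oppr0 //.
    by move=> r' _; rewrite uq // !scaler0.
  rewrite ffunE dgE_D uq // kosH_comp add0r; case: ifP => // _.
  by rewrite /dgdiv z0 map_mx0 !scaler0.
exists u; split=> //; apply/eqP; rewrite -subr_eq0 -oppr_eq0 opprB; apply/eqP.
apply/ffunP => T; apply: dgP => q; apply/rowP => c; apply/mpolyP => m.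
rewrite uE [RHS](_ : _ = 0) ?ffunE ?mxE ?mcoeff0 //.
case: ifPn => // /allP Tm.
have T0 : T = set0.
  by apply/setP => t; rewrite inE; have := Tm t; rewrite mem_enum => /(_ isT)/andP[/negPf].
have -> : m = 0%MM; last by rewrite T0 my.
by apply/mnmP => t; have := Tm t; rewrite mem_enum mnm0E => /(_ isT)/andP[_ /eqP].
Qed.

(* B = K (x) F maps onto A = k (x) F by the constant term of the coefficient of
   e_set0; this is the acyclicity of the kernel. *)
Lemma dgD_exact N y : homX cardT N y -> dgD y = 0 -> dgmax (y set0) ->
  exists u, [/\ homX cardT N.+1 u, dgD u = y & u set0 = 0].
Proof.
move=> hy; have : forall T q, (N.+1 <= q)%N -> y T q = 0.
  by move=> T q Nq; rewrite hy // gtn_eqF // (leq_trans Nq) ?leq_addr.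
move: (N.+1 in X in X -> _) => Q; elim: Q y hy => [|Q IHQ] y hy yQ dy my.
  exists 0; split; first by move=> T q _; rewrite ffunE.
    by rewrite raddf0; apply/ffunP => T; apply: dgP => q; rewrite yQ // ffunE.
  by rewrite ffunE.
(* In the top F-degree Q the cycle condition involves the Koszul differential alone. The primitive u
   found for this component again lies in F-degree Q, so y - dgD u lives in F-degrees below Q. *)
pose top : K := [ffun T => dgpart Q (y T)].
have topE T q : top T q = if q == Q then y T q else 0 by rewrite ffunE.
have kQ T q : (Q <= q)%N -> kosD y T q = 0.
  move=> Qq; have /ffunP/(_ T) := dy; rewrite dgDE [RHS]ffunE.
  by move=> /(congr1 (fun f : E => f q)); rewrite dgE_D /dgd yQ // mul0mx add0r.
have [||u [du u0 uh uq]] := @kosD_exact top.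
- apply/ffunP => T; apply: dgP => q; rewrite [(0 : K) T]ffunE kosD_comp.
  have [->|qQ] := eqVneq q Q.
    rewrite -[RHS](kQ T Q) // kosD_comp; apply: eq_bigr => t _.
    by rewrite topE eqxx.
  by rewrite big1 // => t _; rewrite topE (negPf qQ) !scaler0.
- by move=> q c; rewrite topE; case: ifP => // _; rewrite mxE mcoeff0.
have hu : homX cardT N.+1 u.
  by apply: uh => T q qT; rewrite topE; case: ifP => // _; apply: hy.
have {}uq q : q != Q -> forall T, u T q = 0.
  by move=> qQ; apply: uq => T; rewrite topE (negPf qQ).
have [||||w [hw dw w0]] := IHQ (y - dgD u).
- exact: homXB hy (sf_hom dgD_semifree hu).
- move=> T q Qq; rewrite [(y - _) T]ffunE dgE_D [(- _ : K) T]ffunE dgE_N dgDE dgE_D /dgd.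
  rewrite uq ?gtn_eqF // mul0mx add0r du topE.
  case: eqVneq => [_|qQ]; first exact: subrr.
  by rewrite subr0 yQ // ltn_neqAle eq_sym qQ.
- by rewrite raddfB /= dy dgDD subr0.
- rewrite [(y - _) set0]ffunE [(- _ : K) set0]ffunE; apply: dgmaxB => //.
  rewrite dgDE u0 raddf0 add0r kosDE; apply: dgmax_sum => t _.
  by apply/dgmaxMr/dgmaxMl/dgmax_c; rewrite mcoeffX mnm1_eq0.
exists (w + u); split; first exact: homXD.
  by rewrite raddfD /= dw subrK.
by rewrite ffunE w0 u0 addr0.
Qed.

Lemma dgD_base0 f : dgD (kbase set0 f) = kbase set0 (dgd f).
Proof. exact: kd_base0. Qed.

Lemma kbase0 (T : {set 'I_n}) : kbase T (0 : E) = 0.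
Proof. by apply/ffunP => U; rewrite !ffunE if_same. Qed.

(** By minimality df has coefficients in the maximal ideal, so df e_set0 bounds some u without
    e_set0 term, and f e_set0 - u is a cycle. The element f itself is reached, not only its class in
    k (x) F. *)
Lemma dg_cycle_lift q f : dghom q f ->
  exists b : K, [/\ homX cardT q b, dgD b = 0 & b set0 = f].
Proof.
have hbase q' g : dghom q' g -> homX cardT q' (kbase set0 g).
  move=> hg T r rT; rewrite ffunE; case: eqP => // T0.
  by apply: hg; move: rT; rewrite T0 cards0 addn0.
case: q => [|q] hf.
  exists (kbase set0 f); split; [exact: hbase | | by rewrite ffunE eqxx].
  by rewrite dgD_base0 dghom_d0 // kbase0.
have [|||u [hu du u0]] := @dgD_exact q (kbase set0 (dgd f)).
- exact/hbase/dghom_d.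
- by rewrite dgD_base0 dgdd kbase0.
- by rewrite ffunE eqxx; apply: dgmax_d.
exists (kbase set0 f - u); split; first exact: homXB (hbase _ _ hf) hu.
  by rewrite raddfB /= du dgD_base0 subrr.
by rewrite !ffunE eqxx u0 oppr0 addr0.
Qed.

End Resolution.
(** * The resolution of the residue field *)

Section TruncatedResolution.

Variables (k : fieldType) (n : nat) (I : idealr {mpoly k[n]}).
Hypothesis I_homog : homogeneous_ideal I.
Local Notation R := {ideal_quot I}.
Variable P : gfree R.
Hypothesis P_res : is_resolution (@quot_gr k n I) (irrelevant (@quot_gr k n I)) P.
Variable i : nat.

(** The basis of P in degrees at most i as a single finite type, so that F (x) P has the same shape
    as the Koszul complex over F. *)
Definition pbase := {p : 'I_i.+1 & 'I_(gf_rank P p)}.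
Definition pdeg (j : pbase) : nat := tag j.
Definition pideg (j : pbase) : int := @gf_deg _ P (tag j) (tagged j).
Local Notation XR := {ffun pbase -> R}.
Implicit Types (v w : XR) (j : pbase).

Definition pvec v q : 'rV[R]_(gf_rank P q) :=
  \sum_j v j *: @at_deg R (gf_rank P) (tag j) (delta_mx 0 (tagged j)) q.

Lemma pvec_additive q : zmod_morphism (pvec^~ q).
Proof.
move=> v w; rewrite /pvec -sumrB; apply: eq_bigr => j _.
by rewrite !ffunE scalerBl.
Qed.

Lemma pvecE v j : pvec v (tag j) 0 (tagged j) = v j.
Proof.
rewrite /pvec summxE (bigD1 j) //= big1 => [|j' jj'].
  by rewrite addr0 mxE at_degE mxE !eqxx mulr1.
have [e|ne] := eqVneq (val (tag j')) (val (tag j)); last first.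
  by rewrite at_deg_neq // mxE mxE mulr0.
move: j j' e jj' => [p a] [p' a'] /= /val_inj e; case: _ / e a => a.
rewrite eq_Tagged /= eq_sym => aa'.
by rewrite at_degE !mxE (negPf aa') andbF mulr0.
Qed.

Lemma pvec_ord v (p : 'I_i.+1) c : pvec v p 0 c = v (Tagged _ c).
Proof. exact: (pvecE v (@Tagged _ p (fun p : 'I_i.+1 => 'I_(gf_rank P p)) c)). Qed.

Lemma pvec_gt v q : (i < q)%N -> pvec v q = 0.
Proof.
move=> iq; rewrite /pvec big1 // => j _; rewrite at_deg_neq ?scaler0 //.
by rewrite ltn_eqF // (leq_trans (ltn_ord (tag j))).
Qed.

Definition pof q (w : 'rV[R]_(gf_rank P q)) : XR :=
  [ffun j : pbase => at_deg w (tag j) 0 (tagged j)].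

Lemma pvec_of q (w : 'rV[R]_(gf_rank P q)) q' : (q <= i)%N -> pvec (@pof q w) q' = at_deg w q'.
Proof.
move=> qi; have [iq|q'i] := ltnP i q'.
  by rewrite pvec_gt // at_deg_neq // ltn_eqF // (leq_ltn_trans qi).
apply/rowP => c; have [p pq'] : exists p : 'I_i.+1, q' = p by exists (Ordinal (q'i : (q' < i.+1)%N)).
by case: _ / (esym pq') in c *; rewrite pvec_ord ffunE.
Qed.

Lemma pof_sum q (T : finType) (c : T -> R) (r : T -> 'rV[R]_(gf_rank P q)) j :
  pof (\sum_a c a *: r a) j = \sum_a c a * pof (r a) j.
Proof.
rewrite ffunE; transitivity (\sum_a c a * at_deg (r a) (pdeg j) 0 (tagged j)).
  case: j => p b; rewrite /pdeg /= /at_deg; case: eqP => [e|_].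
    by subst q; rewrite summxE; apply: eq_bigr => a _; rewrite mxE.
  by rewrite mxE big1 // => a _; rewrite mulr0.
by apply: eq_bigr => a _; rewrite ffunE.
Qed.

Lemma pvecP v w : (forall q, (q <= i)%N -> pvec v q = pvec w q) -> v = w.
Proof.
by move=> vw; apply/ffunP => j; rewrite -!pvecE vw // -ltnS ltn_ord.
Qed.

Definition pdif v : XR :=
  [ffun j : pbase => (pvec v (tag j).+1 *m gf_dif P (tag j)) 0 (tagged j)].

Lemma pdif_additive : zmod_morphism pdif.
Proof.
move=> v w; apply/ffunP => j.
by rewrite !ffunE pvec_additive mulmxDl mulNmx !mxE.
Qed.

HB.instance Definition _ := GRing.isZmodMorphism.Build XR XR pdif pdif_additive.

Lemma pvec_dif v q : (q <= i)%N -> pvec (pdif v) q = pvec v q.+1 *m gf_dif P q.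
Proof.
move=> qi; apply/rowP => c.
have [p pq] : exists p : 'I_i.+1, q = p by exists (Ordinal (qi : (q < i.+1)%N)).
by case: _ / (esym pq) in c *; rewrite pvec_ord ffunE.
Qed.

Lemma pdif_dif v : pdif (pdif v) = 0.
Proof.
apply/ffunP => j; rewrite !ffunE.
have [iq|qi] := ltnP i (tag j).+1; first by rewrite pvec_gt // mul0mx mxE.
rewrite pvec_dif // [_ *m _ *m gf_dif _ _](_ : _ = 0) ?mxE //.
by apply/(res_exact P_res); exists (pvec v (tag j).+2).
Qed.

Definition paug v : R := (pvec v 0 *m gf_aug P) 0 0.

Lemma paug_additive : zmod_morphism paug.
Proof. by move=> v w; rewrite /paug pvec_additive mulmxDl mulNmx !mxE. Qed.

HB.instance Definition _ := GRing.isZmodMorphism.Build XR R paug paug_additive.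

Lemma paug_dif v : quot_const (paug (pdif v)) = 0.
Proof.
apply/(irrelevant_quot I_homog)/(res_exact0 P_res).
by exists (pvec v 1); rewrite pvec_dif.
Qed.

Definition psupp p v := forall j, pdeg j != p -> v j = 0.
Definition phom (t : int) v := forall j, @quot_gr k n I (t - pideg j) (v j).

Lemma psupp_vec p v q : psupp p v -> q != p -> pvec v q = 0.
Proof.
move=> sv qp; rewrite /pvec big1 // => j _.
have [jq|jq] := eqVneq (pdeg j) q; last by rewrite at_deg_neq ?scaler0.
by rewrite sv ?scale0r // jq.
Qed.

Lemma psupp_of q (w : 'rV[R]_(gf_rank P q)) : psupp q (@pof q w).
Proof. by move=> j jq; rewrite ffunE at_deg_neq ?mxE // eq_sym. Qed.

Let prP := qpr_proj I_homog.

Lemma phom_of q (w : 'rV[R]_(gf_rank P q)) t :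
  gf_homog (@quot_gr k n I) t w -> phom t (pof w).
Proof.
move=> hw j; rewrite ffunE /at_deg; case: eqP => [e|_]; last first.
  by rewrite mxE; apply: gr0 prP _.
by rewrite /pideg; case: j e => [p c] /= e; subst q; apply: hw.
Qed.

Lemma phom_vec v (p : 'I_i.+1) t : phom t v -> gf_homog (@quot_gr k n I) t (pvec v p).
Proof. by move=> hv c; rewrite pvec_ord; apply: (hv (Tagged _ c)). Qed.

(* Any preimage can be replaced by its homogeneous component. *)
Lemma pdif_lift p v t : (p < i)%N -> psupp p v -> phom t v ->
  (exists w : 'rV[R]_(gf_rank P p.+1), pvec v p = w *m gf_dif P p) ->
  exists w : XR, [/\ psupp p.+1 w, phom t w & pdif w = v].
Proof.
move=> pi sv hv [w vw].
pose u : 'rV_(gf_rank P p.+1) := \row_a qpr (t - @gf_deg _ P p.+1 a) (w 0 a).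
have uE : u *m gf_dif P p = pvec v p.
  have pi1 : (p < i.+1)%N by apply: ltnW.
  have /= hvp := @phom_vec v (Ordinal pi1) t hv.
  rewrite (pr_mulmx prP (ds := @gf_deg _ P p)); last exact: res_dif_homog P_res _.
  by apply/rowP => b; rewrite mxE -vw; apply: gpr_id prP _ _ (hvp b).
exists (pof u); split; first exact: psupp_of.
  by apply: phom_of => a; rewrite mxE; apply: gpr_gr prP _ _.
apply: pvecP => q qi; rewrite pvec_dif // pvec_of //.
have [->|qp] := eqVneq q p; first by rewrite at_degE.
by rewrite at_deg_neq ?eqSS 1?eq_sym // mul0mx (psupp_vec sv).
Qed.

Lemma pdif_exact p v t : (p.+1 < i)%N -> psupp p.+1 v -> phom t v -> pdif v = 0 ->
  exists w : XR, [/\ psupp p.+2 w, phom t w & pdif w = v].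
Proof.
move=> pi sv hv dv; apply: pdif_lift => //; apply/(res_exact P_res).
rewrite -pvec_dif; last by do 2 apply: ltnW.
by rewrite dv; have := pvec_additive p 0 0; rewrite !subrr.
Qed.

Lemma paug_exact v t : (0 < i)%N -> psupp 0 v -> phom t v -> quot_const (paug v) = 0 ->
  exists w : XR, [/\ psupp 1 w, phom t w & pdif w = v].
Proof.
move=> pi sv hv av; apply: pdif_lift => //; apply/(res_exact0 P_res).
exact/(irrelevant_quot I_homog).
Qed.

Lemma paug_one : exists v, [/\ psupp 0 v, phom 0 v & quot_const (paug v) = 1].
Proof.
have [w /(irrelevant_quot I_homog)] := res_surj P_res 1.
rewrite raddfB //= rmorph1 // => /eqP; rewrite subr_eq0 => /eqP w1.
pose u : 'rV_(gf_rank P 0) := \row_a qpr (0 - @gf_deg _ P 0 a) (w 0 a).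
exists (pof u); split; [exact: psupp_of | |].
  by apply: phom_of => a; rewrite mxE; apply: gpr_gr prP _ _.
rewrite /paug pvec_of // at_degE.
rewrite (@pr_mulmx _ _ _ prP _ _ (@gf_deg _ P 0) (fun=> 0)); last first.
  by move=> a b; rewrite subr0 ord1; apply: res_aug_homog P_res _.
by rewrite mxE subrr quot_const_gr0.
Qed.

(** Write v = d u with u in P_(i+1) homogeneous of degree t. As v has coefficients in R_+, u is a
    cycle of k (x) P, so u is a boundary plus a sum of X_a h_a; applying d gives v as the sum of the
    X_a d(h_a). *)
Lemma tor_vanish v t : Tor_eq0 (@quot_gr k n I) P i.+1 t ->
  (0 < i)%N -> psupp i v -> phom t v -> pdif v = 0 -> (forall j, quot_const (v j) = 0) ->
  exists y : 'I_n -> XR, [/\ forall a, psupp i (y a), forall a, pdif (y a) = 0 &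
    forall j, v j = \sum_a \pi_R%qT 'X_a * y a j].
Proof.
move=> tor i0 sv hv dv mv.
have [w vw] : exists w : 'rV[R]_(gf_rank P i.+1), pvec v i = w *m gf_dif P i.
  have : pvec v i.-1.+1 *m gf_dif P i.-1 = 0.
    rewrite -pvec_dif ?leq_pred // dv.
    by have := pvec_additive i.-1 0 0; rewrite !subrr.
  by move=> /(res_exact P_res); rewrite prednK.
have hvi := @phom_vec v ord_max t hv.
pose u : 'rV_(gf_rank P i.+1) := \row_a qpr (t - @gf_deg _ P i.+1 a) (w 0 a).
have uE : u *m gf_dif P i = pvec v i.
  rewrite (pr_mulmx prP (ds := @gf_deg _ P i)); last exact: res_dif_homog P_res _.
  by apply/rowP => b; rewrite mxE -vw; apply: gpr_id prP _ _ (hvi b).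
have [|w' w'E] := tor u.
  split=> [a|c]; first by rewrite mxE; apply: gpr_gr prP _ _.
  rewrite uE; apply/(irrelevant_quot I_homog).
  by rewrite (@pvec_ord v ord_max) mv.
have ex c : exists g : 'I_n -> R,
    (u - w' *m gf_dif P i.+1) 0 c = \sum_a \pi_R%qT 'X_a * g a.
  exact/quot_maxP/(irrelevant_quot I_homog)/w'E.
have [g gE] := boolp.choice ex.
pose h a : 'rV_(gf_rank P i.+1) := \row_c g c a.
exists (fun a => pof (h a *m gf_dif P i)); split=> [a|a|j].
- exact: psupp_of.
- apply/ffunP => j; rewrite !ffunE pvec_of //.
  have [ij|ij] := eqVneq i (tag j).+1; last by rewrite at_deg_neq // mul0mx mxE.
  have e : forall q (r1 : 'rV[R]_(gf_rank P q)) q1, q = q1.+1 ->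
      (exists r2, r1 = r2 *m gf_dif P q) -> at_deg r1 q1.+1 *m gf_dif P q1 = 0.
    by move=> q r1 q1 qE; subst q; rewrite at_degE => /(res_exact P_res).
  by rewrite e ?mxE //; exists (h a).
have -> : v = pof (u *m gf_dif P i).
  apply: pvecP => q qi; rewrite pvec_of // uE.
  have [->|qi'] := eqVneq q i; first by rewrite at_degE.
  by rewrite at_deg_neq 1?eq_sym // (psupp_vec sv).
have -> : u *m gf_dif P i = \sum_a \pi_R%qT 'X_a *: (h a *m gf_dif P i).
  have -> : u *m gf_dif P i = (u - w' *m gf_dif P i.+1) *m gf_dif P i.
    rewrite mulmxBl [X in _ - X](_ : _ = 0) ?subr0 //.
    by apply/(res_exact P_res); exists w'.
  rewrite -[X in X *m _](_ : \sum_a \pi_R%qT 'X_a *: h a = _); last first.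
    by apply/rowP => c; rewrite gE summxE; apply: eq_bigr => a _; rewrite !mxE.
  by rewrite mulmx_suml; apply: eq_bigr => a _; rewrite scalemxAl.
exact: pof_sum.
Qed.

End TruncatedResolution.
(** * Twisted differentials *)

Section Twist.

Variables (k : fieldType) (n : nat).
Local Notation S := {mpoly k[n]}.
Variable I : idealr S.
Local Notation R := {ideal_quot I}.
Variable F : gfree S.
Local Notation JI := [set p : S | p \in (I : pred _)]%classic.
Hypothesis F_res : is_resolution (@mpoly_gr k n) JI F.
Variable G : dg_algebra (@mpoly_gr k n) JI F.
Local Notation E := (dgtot G).
Implicit Types f g h : E.

Section FreeModule.

Variables (T U : finType).
Implicit Types (x y : {ffun T -> E}) (b c : {ffun T -> E}) (m : T -> {ffun U -> E}).

Definition xscale f y : {ffun T -> E} := [ffun j => f * y j].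
Definition xdelta (j : T) : {ffun T -> E} := [ffun j' => if j' == j then 1 else 0].

Lemma xscaleDl f g y : xscale (f + g) y = xscale f y + xscale g y.
Proof. by apply/ffunP => j; rewrite !ffunE mulrDl. Qed.

Lemma xscale0l y : xscale 0 y = 0.
Proof. by apply/ffunP => j; rewrite !ffunE mul0r. Qed.

Lemma xscale0r f : xscale f 0 = 0.
Proof. by apply/ffunP => j; rewrite !ffunE mulr0. Qed.

Lemma xscaleNl f y : xscale (- f) y = - xscale f y.
Proof. by apply/ffunP => j; rewrite !ffunE mulNr. Qed.

Lemma xscale1 y : xscale 1 y = y.
Proof. by apply/ffunP => j; rewrite !ffunE mul1r. Qed.

Lemma xdelta_sum b : b = \sum_j xscale (b j) (xdelta j).
Proof.
apply/ffunP => j; rewrite sum_ffunE (bigD1 j) //= big1 => [|j' jj'].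
  by rewrite !ffunE eqxx mulr1 addr0.
by rewrite !ffunE eq_sym (negPf jj') mulr0.
Qed.

End FreeModule.

Section LinearCombinations.

Variables (T U : finType).
Implicit Types (x y : {ffun T -> E}) (b c : {ffun T -> E}) (m : T -> {ffun U -> E}).

Definition lin b m : {ffun U -> E} := \sum_j xscale (b j) (m j).

Lemma linE b m j : lin b m j = \sum_a b a * m a j.
Proof. by rewrite sum_ffunE; apply: eq_bigr => a _; rewrite ffunE. Qed.

Lemma lin_additive m : zmod_morphism (lin^~ m).
Proof.
move=> b c; rewrite /lin -sumrB; apply: eq_bigr => a _.
by rewrite !ffunE xscaleDl xscaleNl.
Qed.

Lemma linD b c m : lin (b + c) m = lin b m + lin c m.
Proof. exact: (zmorphD (lin_additive m)). Qed.

Lemma lin0 m : lin 0 m = 0.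
Proof. exact: (zmorph0 (lin_additive m)). Qed.

Lemma lin_scale f b m : lin (xscale f b) m = xscale f (lin b m).
Proof.
apply/ffunP => j; rewrite ffunE !linE mulr_sumr; apply: eq_bigr => a _.
by rewrite ffunE mulrA.
Qed.

Lemma lin_delta j m : lin (xdelta j) m = m j.
Proof.
rewrite /lin (bigD1 j) //= big1 => [|a aj]; first by rewrite ffunE eqxx xscale1 addr0.
by rewrite ffunE (negPf aj) xscale0l.
Qed.

Lemma rho_lin b m j : rho (lin b m j) = \sum_a rho (b a) * rho (m a j).
Proof. by rewrite linE raddf_sum; apply: eq_bigr => a _; rewrite /= (rho_multiplicative F_res G).2. Qed.

Lemma homX_lin (degT : T -> nat) (degU : U -> nat) N M b m :
  homX degT N b ->
  (forall j, (degT j <= N)%N -> (N <= M + degT j)%N ->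
     homX degU (M + degT j - N)%N (m j)) ->
  (forall j, (M + degT j < N)%N -> m j = 0) -> homX degU M (lin b m).
Proof.
move=> hb hm m0 j q jq; rewrite linE dgE_sum big1 // => a _.
have [aN|Na] := leqP (degT a) N; last by rewrite (homX_gt hb) ?mul0r.
have [NM|MN] := leqP N (M + degT a); last by rewrite m0 // ffunE mulr0.
have {}hm := hm a aN NM.
have [jM|Mj] := leqP (degU j) (M + degT a - N); last first.
  by rewrite (homX_gt hm) ?mulr0.
apply: (dghomM (homX_dghom hb aN) (homX_dghom hm jM)).
by apply: contraNneq jq => ->; apply/eqP; lia.
Qed.

End LinearCombinations.

Definition leibniz (T : finType) (D : {ffun T -> E} -> {ffun T -> E}) :=
  zmod_morphism D /\
  forall f y, D (xscale f y) = xscale (dgd f) y + xscale (dgs f) (D y).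

(** Restricting the hypothesis to basis elements occurring in b allows a map m constructed only up
    to some degree. *)
Lemma chain_map (T U : finType) D D' (b : {ffun T -> E}) (m : T -> {ffun U -> E}) :
  leibniz D -> leibniz D' ->
  (forall j, b j != 0 -> D' (m j) = lin (D (xdelta j)) m) ->
  D' (lin b m) = lin (D b) m.
Proof.
move=> [DB DM] [DB' DM'] Dm.
rewrite [in RHS](xdelta_sum b) (zmorph_sum DB) (zmorph_sum (lin_additive m)).
rewrite /lin (zmorph_sum DB'); apply: eq_bigr => j _; rewrite -/(lin _ m).
have [->|bj] := eqVneq (b j) 0.
  by rewrite !xscale0l (zmorph0 DB) (zmorph0 DB') lin0.
by rewrite DM' DM Dm // linD !lin_scale lin_delta.
Qed.

Section TwistOp.

Variables (T : finType) (deg : T -> nat) (m : T -> {ffun T -> E}).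
Implicit Types x y : {ffun T -> E}.

(* d (f e_j) = df e_j + s(f) m_j *)
Definition twist y : {ffun T -> E} :=
  [ffun j => dgd (y j)] + lin [ffun j => dgs (y j)] m.

Lemma twist_leibniz : leibniz twist.
Proof.
split=> [x y|f y].
  apply/ffunP => j; rewrite !ffunE !linE raddfB opprD addrACA -sumrB.
  by congr (_ + _); apply: eq_bigr => a _; rewrite !ffunE raddfB mulrBl.
apply/ffunP => j; rewrite !ffunE !linE dgdM mulrDr -addrA; congr (_ + (_ + _)).
rewrite mulr_sumr; apply: eq_bigr => a _; rewrite !ffunE mulrA.
by rewrite -(rmorphM (@dgs _ _ _ _ G)).
Qed.

HB.instance Definition _ :=
  GRing.isZmodMorphism.Build {ffun T -> E} {ffun T -> E} twist twist_leibniz.1.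

Lemma twist_delta j : twist (xdelta j) = m j.
Proof.
have d1 : dgd (1 : E) = 0 by apply: dghom_d0; case.
rewrite /twist -[X in _ + lin X m](_ : xdelta j = _).
  rewrite lin_delta -[RHS]add0r; congr (_ + _); apply/ffunP => j'; rewrite !ffunE.
  by case: ifP => _; rewrite ?raddf0.
apply/ffunP => j'; rewrite !ffunE; case: ifP => _; last by rewrite raddf0.
by rewrite (rmorph1 (@dgs _ _ _ _ G)).
Qed.

Definition twistR (v : {ffun T -> R}) : {ffun T -> R} :=
  [ffun j => \sum_a v a * rho (m a j)].

Lemma twistR_additive : zmod_morphism twistR.
Proof.
move=> v w; apply/ffunP => j; rewrite !ffunE -sumrB; apply: eq_bigr => a _.
by rewrite !ffunE mulrBl.
Qed.

HB.instance Definition _ := GRing.isZmodMorphism.Build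
  {ffun T -> R} {ffun T -> R} twistR twistR_additive.

Hypothesis m0 : forall j, deg j = 0%N -> m j = 0.
Hypothesis hm : forall j, homX deg (deg j).-1 (m j).
Hypothesis mD : forall j, twist (m j) = 0.

(** D (D (f e_j)) is d(df) e_j + (s(df) + d(s f)) m_j + f D(m_j), where each term vanishes.
    Triangularity holds because m_j has total degree deg j - 1. *)
Lemma twist_semifree : semifree deg twist twistR.
Proof.
have [DB DM] := twist_leibniz.
split=> [x|N x hx|p x x0 j pj|x].
- change (twist (twist x) = 0); rewrite [x]xdelta_sum !(zmorph_sum DB) big1 // => j _.
  rewrite (DM (x j)) twist_delta (zmorphD DB) (DM (dgd _)) (DM (dgs _)).
  rewrite (twist_delta j).
  rewrite (mD j).
  rewrite [X in _ + (_ + X)]xscale0r [X in _ + X]addr0.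
  by rewrite (dgdd F_res) xscale0l add0r dgds xscaleNl addrN.
- change (homX deg N (twist x)).
  apply: homXD => [j q jq|]; first by rewrite ffunE /dgd hx ?mul0mx ?addSn.
  apply: (@homX_lin _ _ deg deg N.+1).
  + by move=> j q jq; rewrite ffunE /dgs hx ?scaler0.
  + move=> j jN Nj; have -> : (N + deg j - N.+1 = (deg j).-1)%N by lia.
    exact: hm.
  + by move=> j Nj; apply: m0; lia.
- change (twist x j = dgd (x j)); rewrite ffunE [X in X + _]ffunE linE big1 ?addr0 // => a _; rewrite ffunE.
  have [pa|ap] := leqP p (deg a); first by rewrite x0 // raddf0 mul0r.
  have [a0|a0] := posnP (deg a); first by rewrite m0 // ffunE mulr0.
  rewrite (homX_gt (@hm a)) ?mulr0 //; lia.
change (rhoX (twist x) = twistR (rhoX x)).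
apply/ffunP => j; rewrite [LHS]ffunE [twist x j]ffunE raddfD /= rho_lin ffunE.
rewrite rho_d // add0r [RHS]ffunE.
by apply: eq_bigr => a _; rewrite !ffunE rho_s.
Qed.

End TwistOp.

End Twist.
(** * Comparison with the Koszul complex *)

Section Core.

Variables (k : fieldType) (n : nat).
Local Notation S := {mpoly k[n]}.
Variable I : idealr S.
Hypothesis I_homog : homogeneous_ideal I.
Hypothesis I_nolin : no_linear_forms I.
Local Notation R := {ideal_quot I}.
Variable F : gfree S.
Local Notation JI := [set p : S | p \in (I : pred _)]%classic.
Hypothesis F_res : is_resolution (@mpoly_gr k n) JI F.
Hypothesis F_min : is_minimal (@mpoly_gr k n) F.
Variable G : dg_algebra (@mpoly_gr k n) JI F.
Local Notation E := (dgtot G).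
Variable P : gfree R.
Hypothesis P_res : is_resolution (@quot_gr k n I) (irrelevant (@quot_gr k n I)) P.
Variable i : nat.
Local Notation B := (pbase P i).
Local Notation X := {ffun B -> E}.
Local Notation XR := {ffun B -> R}.
Local Notation K := {ffun {set 'I_n} -> E}.
Local Notation cardT := (fun T : {set 'I_n} => #|T|).
Implicit Types (f g h : E) (j : B) (v w : XR).

Section CycleLift.

Variables (T : finType) (deg : T -> nat).
Variables (D : {additive {ffun T -> E} -> {ffun T -> E}}).
Variables (Dr : {additive {ffun T -> R} -> {ffun T -> R}}).
Hypothesis XP : semifree deg D Dr.

Lemma homX0 N : homX deg N (0 : {ffun T -> E}).
Proof. by move=> j q _; rewrite ffunE. Qed.

(** On a basis element of degree below N the coefficient has positive F-degree, and [rho] kills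
    it. *)
Lemma homX_supp N (x : {ffun T -> E}) (j : T) : homX deg N x -> deg j != N -> rhoX x j = 0.
Proof.
move=> hx jN; rewrite ffunE; have [lt|gt] := leqP (deg j) N; last first.
  by rewrite (homX_gt hx) // raddf0.
have lt' : (deg j < N)%N by rewrite ltn_neqAle jN.
have := homX_dghom hx lt; have -> : (N - deg j = (N - deg j).-1.+1)%N by lia.
exact: rho_hom.
Qed.

Lemma sf_cycle_lift N (v : {ffun T -> R}) :
  (forall j : T, deg j != N -> v j = 0) -> Dr v = 0 ->
  exists y, [/\ homX deg N y, D y = 0 & rhoX y = v].
Proof.
(* Degree 0 is apart, [sf_lift] having no degree -1 to start from; there the scalar lift is already
   a cycle. *)
case: N => [|N] sv dv; last first.
  by apply: (sf_lift F_res XP (@homX0 N)); rewrite ?raddf0.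
pose y : {ffun T -> E} := [ffun j => if deg j == 0%N then dgc G (repr (v j)) else 0].
have hy : homX deg 0 y.
  move=> j q jq; rewrite ffunE; have [j0|//] := eqVneq (deg j) 0%N.
  by apply: (dghom_c _ (repr (v j))); apply: contraNneq jq => ->; rewrite j0.
exists y; split=> //.
  apply/ffunP => j; rewrite (sf_tri XP (p := 1)) // => [|a a0]; last first.
    by rewrite ffunE gtn_eqF.
  rewrite [RHS]ffunE ffunE; case: ifP => _; first exact: dgd_c.
  exact: raddf0.
apply/ffunP => j; rewrite !ffunE; case: ifPn => j0.
  by rewrite rho_c // reprK.
by rewrite raddf0 sv.
Qed.

End CycleLift.

Definition rdelta j : XR := [ffun a => (a == j)%:R].

Lemma pvec_delta j q :
  pvec (rdelta j) q = @at_deg R (gf_rank P) (tag j) (delta_mx 0 (tagged j)) q.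
Proof.
rewrite /pvec (bigD1 j) //= big1 => [|a aj]; first by rewrite ffunE eqxx scale1r addr0.
by rewrite ffunE (negPf aj) scale0r.
Qed.

Lemma pdif_sum v a : pdif v a = \sum_j v j * pdif (rdelta j) a.
Proof.
rewrite ffunE /pvec mulmx_suml summxE; apply: eq_bigr => j _.
by rewrite -scalemxAl mxE ffunE pvec_delta.
Qed.

Lemma paug_sum v : paug v = \sum_j v j * paug (rdelta j).
Proof.
rewrite /paug {1}/pvec mulmx_suml summxE; apply: eq_bigr => j _.
by rewrite -scalemxAl mxE pvec_delta.
Qed.

Lemma rdelta_supp j : psupp (pdeg j) (rdelta j).
Proof.
by move=> a aj; have [e|ne] := eqVneq a j;
  [rewrite e eqxx in aj | rewrite ffunE (negPf ne)].
Qed.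

Lemma paug_delta j : pdeg j != 0%N -> paug (rdelta j) = 0.
Proof.
move=> j0; rewrite /paug (psupp_vec (@rdelta_supp j)) 1?eq_sym //.
by rewrite mul0mx mxE.
Qed.

Lemma pdif_supp p v : psupp p v -> forall j, (pdeg j).+1 != p -> pdif v j = 0.
Proof.
by move=> sv j jp; rewrite ffunE (psupp_vec sv jp) mul0mx mxE.
Qed.

Lemma twistR_pdif p (m : B -> X) v : psupp p v ->
  (forall j, pdeg j = p -> rhoX (m j) = pdif (rdelta j)) -> twistR m v = pdif v.
Proof.
move=> sv rm; apply/ffunP => a; rewrite pdif_sum ffunE; apply: eq_bigr => j _.
have [jp|jp] := eqVneq (pdeg j) p; last by rewrite (sv j jp) !mul0r.
by rewrite -rm // ffunE.
Qed.

(** Induction on the basis degree p: the differential of a basis element of degree p of P is a cycle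
    of degree p - 1, which lifts to a cycle of the part built so far. Keeping m zero from degree p
    on makes [twist m] a differential of the whole module at every stage. *)
Lemma pdif_twist : exists m : B -> X,
  [/\ forall j, pdeg j = 0%N -> m j = 0,
      forall j, homX (@pdeg _ _ _ P i) (pdeg j).-1 (m j),
      forall j, twist m (m j) = 0 & forall j, rhoX (m j) = pdif (rdelta j)].
Proof.
have step p : exists m : B -> X,
  [/\ forall j, (pdeg j = 0%N \/ (p <= pdeg j)%N) -> m j = 0,
      forall j, homX (@pdeg _ _ _ P i) (pdeg j).-1 (m j),
      forall j, twist m (m j) = 0 &
      forall j, (pdeg j < p)%N -> rhoX (m j) = pdif (rdelta j)].
  elim: p => [|p [m [m0 hm mD rm]]].
    exists (fun=> 0); split=> // j; first exact: homX0.
    exact: (zmorph0 (twist_leibniz _).1).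
  have XP : semifree (@pdeg _ _ _ P i) (twist m) (twistR m).
    by apply: twist_semifree => // j j0; apply: m0; left.
  have ex j : exists y : X, pdeg j = p -> [/\ pdeg j = 0%N -> y = 0,
      homX (@pdeg _ _ _ P i) (pdeg j).-1 y, twist m y = 0 &
      rhoX y = pdif (rdelta j)].
    have [jp|jp] := eqVneq (pdeg j) p; last by exists 0 => /eqP; rewrite (negPf jp).
    have [p0|p0] := posnP p.
      exists 0 => _; split=> //; first exact: homX0.
        exact: (zmorph0 (twist_leibniz _).1).
      rewrite raddf0; apply/esym/ffunP => a; rewrite [RHS]ffunE.
      by apply: (pdif_supp (@rdelta_supp j)); rewrite jp p0.
    have sv : psupp p.-1 (pdif (rdelta j)).
      move=> a ap; apply: (pdif_supp (@rdelta_supp j)).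
      by apply: contraNneq ap; rewrite jp => <-.
    have [|y [hy Dy ry]] := sf_cycle_lift XP sv.
      rewrite -[RHS](pdif_dif P_res (rdelta j)); apply: (twistR_pdif sv) => a ap.
      by apply: rm; rewrite ap prednK.
    by exists y => _; split=> //; [rewrite jp => p00; rewrite p00 in p0 | rewrite jp].
  have [r rP] := boolp.choice ex.
  pose m' j := if pdeg j == p then r j else m j.
  have hm' j : homX (@pdeg _ _ _ P i) (pdeg j).-1 (m' j).
    by rewrite /m'; case: eqP => [/rP[]|].
  have m'0 j : pdeg j = 0%N \/ (p < pdeg j)%N -> m' j = 0.
    move=> j0; rewrite /m'; case: eqP => jp.
      by case: j0 => [j0|]; [case: (rP j jp) => -> | rewrite jp ltnn].
    by apply: m0; case: j0 => [|/ltnW]; [left|right].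
  have tw (x : X) : (forall j, (p <= pdeg j)%N -> x j = 0) -> twist m' x = twist m x.
    move=> x0; congr (_ + _); apply: eq_bigr => j _; rewrite ffunE /m'.
    by case: eqP => // jp; rewrite x0 ?jp // raddf0 !xscale0l.
  exists m'; split=> // j.
    rewrite tw => [|a pa].
      by rewrite /m'; case: eqP => [/rP[]|].
    have [jp|jp] := leqP (pdeg j) p; last by rewrite m'0 ?ffunE //; right.
    have [j0|j0] := posnP (pdeg j); first by rewrite m'0 ?ffunE //; left.
    by apply: (homX_gt (@hm' j)); lia.
  rewrite ltnS leq_eqVlt /m'; case: eqP => [/rP[]|_ /=] //; exact: rm.
have [m [m0 hm mD rm]] := step i.+1; exists m; split=> // j.
  by move=> j0; apply: m0; left.
by apply: rm; apply: ltn_ord.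
Qed.

Hypothesis i_gt0 : (0 < i)%N.

Section Comparison.

Variable m : B -> X.
Hypothesis m0 : forall j, pdeg j = 0%N -> m j = 0.
Hypothesis hm : forall j, homX (@pdeg _ _ _ P i) (pdeg j).-1 (m j).
Hypothesis mD : forall j, twist m (m j) = 0.
Hypothesis rm : forall j, rhoX (m j) = pdif (rdelta j).

Local Notation homP := (homX (@pdeg _ _ _ P i)).

Let XP : semifree (@pdeg _ _ _ P i) (twist m) (twistR m) := twist_semifree F_res m0 hm mD.
Let gP := qpr_proj I_homog.

Let rcB : zmod_morphism (@quot_const _ _ I) := quot_const_additive I_homog.
Let rcM : {morph @quot_const _ _ I : r s / r * s} := (quot_const_monoid I_homog).2.

Lemma twistRE v : twistR m v = pdif v.
Proof.
apply/ffunP => a; rewrite pdif_sum ffunE; apply: eq_bigr => j _.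
by rewrite -rm ffunE.
Qed.

Lemma pdif_rho (x : X) : pdif (rhoX x) = rhoX (twist m x).
Proof. by rewrite -twistRE; apply/esym/(sf_rho XP). Qed.

Lemma dgD_leibniz : leibniz (@dgD _ _ _ _ G).
Proof.
split=> [|f y]; first exact: kd_additive.
exact: (kd_scale (@kxC _ _ _ _ G) (@dgdM _ _ _ _ G)).
Qed.

Lemma xdelta_hom (T : {set 'I_n}) : homX cardT #|T| (xdelta G T).
Proof.
move=> U q qU; rewrite ffunE; case: eqP => [UT|//].
by case: q qU => // /eqP[]; rewrite UT.
Qed.

Lemma dgD_delta0 : dgD (xdelta G set0) = 0 :> K.
Proof.
have -> : xdelta G set0 = kbase set0 (1 : E) by [].
by rewrite dgD_base0 dghom_d0 ?kbase0 //; case.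
Qed.

Lemma dgD_delta_hom (T : {set 'I_n}) p : #|T| = p.+1 ->
  homX cardT p (dgD (xdelta G T)).
Proof.
by move=> Tp; apply: (sf_hom (dgD_semifree F_res G)); rewrite -Tp; apply: xdelta_hom.
Qed.

Lemma dgD_delta_lt (T U : {set 'I_n}) : dgD (xdelta G T) U != 0 -> (#|U| < #|T|)%N.
Proof.
apply: contra_neqT; rewrite -leqNgt => TU.
have [T0|T0] := posnP #|T|.
  by move/eqP: T0; rewrite cards_eq0 => /eqP->; rewrite dgD_delta0 ffunE.
by apply: (homX_gt (@dgD_delta_hom T #|T|.-1 _)); rewrite prednK.
Qed.

Lemma rho_dgD_delta (T U : {set 'I_n}) : quot_gr 1 (rho (dgD (xdelta G T) U)).
Proof.
have /ffunP/(_ U) := sf_rho (dgD_semifree F_res G) (xdelta G T).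
rewrite ffunE => ->; rewrite ffunE; apply: (gr_sum gP) => t tU.
apply: (gr_sign gP); rewrite -[1]addr0; apply: (grM gP).
  by exists 'X_t => //=; rewrite dhomogX /= mdeg1.
rewrite !ffunE; case: eqP => _; last by rewrite raddf0; apply: (gr0 gP).
by rewrite rho1 //; exists 1 => /=; rewrite ?dhomog1 ?rmorph1.
Qed.

(** Induction on |T|: the image of dgD e_T is a cycle whose reduction has internal degree |T|, hence
    a preimage in P of that degree, which [sf_lift] lifts. The internal degree is kept because Tor
    will be known to vanish in degree tau only. *)
Lemma comparison_map : exists kap : {set 'I_n} -> X, forall T : {set 'I_n}, (#|T| <= i)%N ->
  [/\ homP #|T| (kap T), phom #|T| (rhoX (kap T)),
      twist m (kap T) = lin (dgD (xdelta G T)) kap &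
      T = set0 -> quot_const (paug (rhoX (kap T))) = 1].
Proof.
have step p : (p <= i.+1)%N -> exists kap : {set 'I_n} -> X,
    forall T : {set 'I_n}, (#|T| < p)%N ->
  [/\ homP #|T| (kap T), phom #|T| (rhoX (kap T)),
      twist m (kap T) = lin (dgD (xdelta G T)) kap &
      T = set0 -> quot_const (paug (rhoX (kap T))) = 1].
  elim: p => [_|p IHp pi]; first by exists (fun=> 0).
  have {IHp} [kap kapP] := IHp (ltnW pi).
  have ex (T : {set 'I_n}) : exists y, #|T| = p -> [/\ homP p y, phom p (rhoX y),
      twist m y = lin (dgD (xdelta G T)) kap & T = set0 -> quot_const (paug (rhoX y)) = 1].
    have [Tp|Tp] := eqVneq #|T| p; last by exists 0 => /eqP; rewrite (negPf Tp).
    case: p => [|q] in pi kapP Tp *; last first.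
      pose b := dgD (xdelta G T); pose x := lin b kap.
      have hb : homX cardT q b := dgD_delta_hom Tp.
      have bU U : b U != 0 -> (#|U| < q.+1)%N.
        by move/dgD_delta_lt; rewrite Tp.
      have hx : homP q x.
        apply: (homX_lin hb) => U; last by lia.
        by move=> qU _; rewrite addKn; case: (kapP U).
      have Dx : twist m x = 0.
        rewrite (chain_map dgD_leibniz (twist_leibniz m)) => [|U /bU/kapP[]//].
        by rewrite (dgDD F_res) lin0.
      have rx j : rhoX x j = \sum_U rho (b U) * rho (kap U j).
        by rewrite ffunE rho_lin.
      have hrx : phom q.+1 (rhoX x).
        move=> j; rewrite rx; apply: (gr_sum gP) => U _.
        have [Uq|Uq] := eqVneq #|U| q; last first.
          have := homX_supp hb Uq; rewrite ffunE => ->.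
          by rewrite mul0r; apply: (gr0 gP).
        rewrite -add1n PoszD -addrA; apply: (grM gP); first exact: rho_dgD_delta.
        have [|_ /(_ j) + _ _] := kapP U; first by rewrite Uq.
        by rewrite ffunE Uq.
      have sx : psupp q (rhoX x) by move=> j jq; apply: homX_supp hx jq.
      have [w [sw hw dw]] : exists w : XR, [/\ psupp q.+1 w, phom q.+1 w & pdif w = rhoX x].
        (* At P_0, exactness asks for an augmentation in R_+; the coefficients of the reduction of
           dgD e_T have degree 1. *)
        case: q => [|q] in pi kapP Tp b hb bU x hx Dx rx hrx sx *.
          apply: paug_exact => //; rewrite paug_sum (zmorph_sum rcB) big1 // => j _.
          rewrite rcM rx (zmorph_sum rcB) big1 ?mul0r // => U _.
          by rewrite rcM (quot_const_gr I_homog (rho_dgD_delta T U)) // mul0r.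
        by apply: pdif_exact => //; rewrite pdif_rho Dx raddf0.
      have [|y [hy Dy ry]] := sf_lift F_res XP hx Dx sw; first by rewrite /= twistRE.
      exists y => _; split; rewrite ?ry //.
      by move=> T0; rewrite T0 cards0 in Tp.
    have [v [sv hv av]] := paug_one I_homog P_res i.
    have [|y [hy Dy ry]] := sf_cycle_lift XP sv.
      rewrite /= twistRE; apply/ffunP => j; rewrite [RHS]ffunE.
      exact: pdif_supp sv _ _.
    have /eqP := Tp; rewrite cards_eq0 => /eqP T0.
    exists y => _; split; rewrite ?ry //; by rewrite Dy T0 dgD_delta0 lin0.
  have [r rP] := boolp.choice ex.
  pose kap' (T : {set 'I_n}) := if #|T| == p then r T else kap T.
  have lind (T : {set 'I_n}) : (#|T| <= p)%N -> lin (dgD (xdelta G T)) kap' = lin (dgD (xdelta G T)) kap.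
    move=> Tp; apply: eq_bigr => U _.
    have [->|/dgD_delta_lt UT] := eqVneq (dgD (xdelta G T) U) 0.
      by rewrite !xscale0l.
    by rewrite /kap' ltn_eqF // (leq_trans UT).
  exists kap' => T; rewrite ltnS leq_eqVlt => Tp; rewrite lind; last by rewrite leq_eqVlt.
  rewrite /kap'; case: eqP Tp => [Tp _|_ /= /kapP//].
  by case: (rP T Tp) => hy hr Dy y1; split; rewrite ?Tp.
have [kap kapP] := step i.+1 (leqnn _); exists kap => T Ti; exact: kapP.
Qed.

Variable lam : E -> k.
Hypothesis lamB : zmod_morphism lam.
Hypothesis lam_max : forall f, dgmax f -> lam f = 0.
Hypothesis lamM : forall p q f g, (0 < p)%N -> (0 < q)%N ->
  dghom p f -> dghom q g -> lam (f * g) = 0.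
Hypothesis lamc : forall a f, lam (dgc G a * f) = a@_0 * lam f.

Lemma lam0l f g : dghom 0 f -> lam (f * g) = quot_const (rho f) * lam g.
Proof.
move=> hf; have [u _ fE] := dg0_decomp F_res hf; rewrite {1}fE mulrDl (zmorphD lamB).
rewrite lamc [X in _ + X]lam_max ?addr0; last exact/dgmaxMl/dgmax_d.
by rewrite /rho quot_const_pi.
Qed.

Lemma lam0r f g : dghom 0 f -> lam (g * f) = quot_const (rho f) * lam g.
Proof.
move=> hf; have [u _ fE] := dg0_decomp F_res hf; rewrite {1}fE mulrDr (zmorphD lamB).
rewrite dgcC lamc [X in _ + X]lam_max ?addr0; last exact/dgmaxMr/dgmax_d.
by rewrite /rho quot_const_pi.
Qed.

(* lam is a derivation of F with values in k; Lam is the F-linear map from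
   F (x) P to the F-module k (+) k it defines, followed by the projection onto
   the second summand. *)
Definition Lam (x : X) : k := \sum_j quot_const (paug (rdelta j)) * lam (x j).

Lemma LamB : zmod_morphism Lam.
Proof.
move=> x y; rewrite /Lam -sumrB; apply: eq_bigr => j _.
by rewrite !ffunE lamB mulrBr.
Qed.

Lemma const_paug v : quot_const (paug v) = \sum_j quot_const (paug (rdelta j)) * quot_const (v j).
Proof.
rewrite paug_sum (zmorph_sum rcB); apply: eq_bigr => j _.
by rewrite rcM mulrC.
Qed.

Lemma const_paug_delta j : pdeg j != 0%N -> quot_const (paug (rdelta j)) = 0.
Proof. by move/paug_delta->; apply: zmorph0 rcB. Qed.

(** The terms d(u_j) vanish by minimality. In s(u_a) m_a the left factor has positive degree since
    deg a <= i, so [lamM] applies unless deg a = 1. Then the coefficients of m_a lie in F_0 and act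
    through [rho], giving the augmentation of a boundary of P. *)
Lemma Lam_dif (u : X) : homP i.+1 u -> Lam (twist m u) = 0.
Proof.
move=> hu; rewrite /Lam.
transitivity (\sum_j \sum_a quot_const (paug (rdelta j)) * lam (dgs (u a) * m a j)).
  apply: eq_bigr => j _; rewrite -mulr_sumr; congr (_ * _).
  rewrite ffunE (zmorphD lamB) ffunE lam_max ?add0r; last exact: dgmax_d.
  by rewrite linE (zmorph_sum lamB); apply: eq_bigr => a _; rewrite ffunE.
rewrite exchange_big big1 //= => a _.
have [a0|a0] := posnP (pdeg a).
  by rewrite big1 // => j _; rewrite m0 // ffunE mulr0 (zmorph0 lamB) mulr0.
have ai : (pdeg a <= i)%N by rewrite -ltnS; apply: ltn_ord.
have hua : dghom (i.+1 - pdeg a)%N (dgs (u a)).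
  exact/dghom_s/homX_dghom/leqW.
transitivity (\sum_j quot_const (paug (rdelta j)) * (quot_const (rhoX (m a) j) * lam (dgs (u a)))).
  apply: eq_bigr => j _.
  have [j0|j0] := eqVneq (pdeg j) 0%N; last by rewrite const_paug_delta // !mul0r.
  congr (_ * _).
  have hma : dghom ((pdeg a).-1 - pdeg j)%N (m a j).
    by apply: homX_dghom (@hm a) _; rewrite j0.
  rewrite j0 subn0 in hma; have [a1|a1] := posnP (pdeg a).-1.
    by rewrite a1 in hma; rewrite lam0r // ffunE.
  rewrite (lamM _ _ hua hma) //; last by lia.
  by rewrite ffunE -[(pdeg a).-1]prednK // in hma *; rewrite (rho_hom hma) (zmorph0 rcB) mul0r.
under eq_bigr do rewrite mulrA.
by rewrite -mulr_suml -const_paug rm (paug_dif I_homog P_res) mul0r.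
Qed.

Lemma Lam_ker (x : X) : homP i x -> twist m x = 0 -> rhoX x = 0 -> Lam x = 0.
Proof.
move=> hx Dx rx; have [u [hu <- _]] := sf_ker_exact F_res XP hx Dx rx.
exact: Lam_dif.
Qed.

Variable kap : {set 'I_n} -> X.
Hypothesis kapP : forall T : {set 'I_n}, (#|T| <= i)%N ->
  [/\ homP #|T| (kap T), phom #|T| (rhoX (kap T)),
      twist m (kap T) = lin (dgD (xdelta G T)) kap &
      T = set0 -> quot_const (paug (rhoX (kap T))) = 1].

(** For 0 < |T| < i the coefficients at P_0 are products of elements of positive degree. For |T| = i
    the coefficient b_T acts through its augmentation, which is in R_+. What remains is T = set0,
    where [kap] has augmentation 1. *)
Lemma Lam_kap (b : K) : homX cardT i b ->
  (forall T : {set 'I_n}, #|T| = i -> quot_const (rho (b T)) = 0) -> Lam (lin b kap) = lam (b set0).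
Proof.
move=> hb rb; rewrite /Lam.
transitivity (\sum_j \sum_T quot_const (paug (rdelta j)) * lam (b T * kap T j)).
  apply: eq_bigr => j _; rewrite -mulr_sumr linE; congr (_ * _).
  exact: zmorph_sum lamB _ _ _ _.
rewrite exchange_big (bigD1 set0) //= [X in _ + X]big1 => [|T T0].
  rewrite addr0; have [|h0 _ _ /(_ erefl) a1] := kapP (T := set0); first by rewrite cards0.
  transitivity (\sum_j quot_const (paug (rdelta j)) * (quot_const (rhoX (kap set0) j) * lam (b set0))).
    apply: eq_bigr => j _.
    have [j0|j0] := eqVneq (pdeg j) 0%N; last by rewrite const_paug_delta // !mul0r.
    have k0 : dghom 0%N (kap set0 j).
      have -> : 0%N = (#|@set0 'I_n| - pdeg j)%N by rewrite cards0 j0.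
      by apply: homX_dghom h0 _; rewrite j0.
    by rewrite ffunE lam0r.
  under eq_bigr do rewrite mulrA.
  by rewrite -mulr_suml -const_paug a1 mul1r.
rewrite big1 // => j _.
have [j0|j0] := eqVneq (pdeg j) 0%N; last by rewrite const_paug_delta // mul0r.
have [Ti|iT] := leqP #|T| i; last first.
  by rewrite (homX_gt hb) // mul0r (zmorph0 lamB) mulr0.
have hbT := homX_dghom hb Ti.
have [Ti'|Ti'] := eqVneq #|T| i.
  by rewrite lam0l ?rb ?mul0r ?mulr0 //; move: hbT; rewrite /= Ti' subnn.
have [hk _ _ _] := kapP Ti.
have hkT : dghom #|T| (kap T j).
  by rewrite -[#|T|]subn0 -j0; apply: homX_dghom hk _; rewrite j0.
rewrite (lamM _ _ hbT hkT) ?mulr0 //; last by rewrite card_gt0.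
by rewrite subn_gt0 ltn_neqAle Ti'.
Qed.

(** The reduction of the image x of b is a sum of X_a y_a with y_a cycles of P. Lifting these to
    cycles z_a, x and the sum of the X_a z_a differ by a cycle killed by [rhoX], so [Lam] agrees on
    both, and it kills multiples of X_a. *)
Lemma tor_detect tau (b : K) : Tor_eq0 (@quot_gr k n I) P i.+1 tau ->
  homX cardT i b -> dgD b = 0 ->
  (forall T : {set 'I_n}, #|T| = i -> quot_gr (tau - i%:Z) (rho (b T))) ->
  lam (b set0) = 0.
Proof.
move=> tor hb db gb.
have hz T : quot_const (rho (b T)) = 0.
  have zc : kz_cycle (@qx _ _ I) i (rhoX b).
    split; first by move=> U Ui; apply: homX_supp hb Ui.
    by have /= <- := sf_rho (dgD_semifree F_res G) b; rewrite /= db raddf0.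
  by have := kz_cycle_const0 I_homog I_nolin T i_gt0 zc; rewrite ffunE.
have rb0 (T : {set 'I_n}) : #|T| != i -> rho (b T) = 0.
  by move=> Ti; have := homX_supp hb Ti; rewrite ffunE.
pose x := lin b kap.
have bi T : b T != 0 -> (#|T| <= i)%N.
  by apply: contra_neqT; rewrite -ltnNge => iT; apply: homX_gt hb _.
have hx : homP i x.
  apply: (homX_lin hb) => T; last by lia.
  by move=> Ti _; rewrite addKn; case: (kapP Ti).
have Dx : twist m x = 0.
  rewrite (chain_map dgD_leibniz (twist_leibniz m)) => [|T /bi/kapP[]//].
  by rewrite db lin0.
have rx j : rhoX x j = \sum_T rho (b T) * rho (kap T j) by rewrite ffunE rho_lin.
have sx : psupp i (rhoX x) by move=> j jq; apply: homX_supp hx jq.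
have hrx : phom tau (rhoX x).
  move=> j; rewrite rx; apply: (gr_sum gP) => T _.
  have [Ti|Ti] := eqVneq #|T| i; last by rewrite rb0 // mul0r; apply: (gr0 gP).
  rewrite -(subrK i%:Z tau) -addrA; apply: (grM gP); first exact: gb.
  have [|_ /(_ j) + _ _] := kapP (T := T); first by rewrite Ti.
  by rewrite ffunE Ti.
have dx : pdif (rhoX x) = 0 by rewrite pdif_rho Dx raddf0.
have mx j : quot_const (rhoX x j) = 0.
  rewrite rx (zmorph_sum rcB) big1 // => T _.
  by rewrite rcM hz mul0r.
have [y [sy dy xy]] := tor_vanish I_homog P_res tor i_gt0 sx hrx dx mx.
have ex a : exists z, [/\ homP i z, twist m z = 0 & rhoX z = y a].
  by apply: (sf_cycle_lift XP (sy a)); rewrite /= twistRE.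
have [z zP] := boolp.choice ex.
have L0 : Lam (x - \sum_a xscale (kx G a) (z a)) = 0.
  apply: Lam_ker.
  - apply: homXB hx _; apply: homX_sum => a _ j q jq; rewrite ffunE dgcl.
    by have [hz' _ _] := zP a; rewrite hz' ?scaler0.
  - have [DB DM] := twist_leibniz m.
    rewrite DB Dx (zmorph_sum DB) big1 ?subr0 // => a _; have [_ Dz _] := zP a.
    by rewrite DM Dz xscale0r addr0 dgd_c xscale0l.
  apply/ffunP => j; rewrite [RHS]ffunE (rhoX_additive x) [LHS]ffunE xy.
  rewrite [X in _ + X]ffunE (zmorph_sum (@rhoX_additive _ _ _ _ G _)) sum_ffunE -sumrB big1 // => a _.
  have [_ _ <-] := zP a; rewrite !ffunE.
  by rewrite (rho_multiplicative F_res G).2 rho_c // subrr.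
rewrite -Lam_kap //; move/eqP: L0; rewrite LamB subr_eq0 => /eqP->.
rewrite (zmorph_sum LamB) big1 // => a _; rewrite /Lam big1 // => j _.
by rewrite ffunE lamc mcoeffX mnm1_eq0 mul0r mulr0.
Qed.

End Comparison.

End Core.
(** * Decomposable classes *)

Section KoszulProduct.

Variables (A : comNzRingType) (n : nat) (x : 'I_n -> A).
Local Notation K := {ffun {set 'I_n} -> A}.
Implicit Types y z w : K.

Lemma kz_difE y : kz_dif x y = kd x (idfun : A -> A) (\0 : A -> A) y.
Proof.
apply/ffunP => T; rewrite !ffunE add0r; apply: eq_bigr => t _.
by congr ((-1) ^+ _ * _); apply: eq_card => u; rewrite in_bset inE.
Qed.

Lemma kz_mulE y z : kz_mul y z = kmul (idfun : A -> A) y z.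
Proof.
apply/ffunP => T; rewrite !ffunE; apply: eq_bigr => U _; congr (_ * (_ * _)).
by elim: #|U| => //= m <-.
Qed.

Lemma kz_dif_dif y : kz_dif x (kz_dif x y) = 0.
Proof.
rewrite !kz_difE; apply: kd_kd => //= *; rewrite ?oppr0 ?mul0r ?mulr0 ?addr0 //.
exact: mulrC.
Qed.

Lemma kz_dif_mul y z :
  kz_dif x (kz_mul y z) = kz_mul (kz_dif x y) z + kz_mul (ktw idfun y) (kz_dif x z).
Proof.
rewrite !kz_mulE !kz_difE; apply: kd_kmul => //= *;
  rewrite ?oppr0 ?mul0r ?mulr0 ?addr0 //.
exact: mulrC.
Qed.

Lemma kz_mulDl y w z : kz_mul (y + w) z = kz_mul y z + kz_mul w z.
Proof. by rewrite !kz_mulE kmulDl. Qed.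

Lemma kz_mulDr y w z : kz_mul y (w + z) = kz_mul y w + kz_mul y z.
Proof. by rewrite !kz_mulE kmulDr. Qed.

Lemma kz_H_mul_pi i y z : kz_cycle x i y -> kz_dif x z = 0 ->
  kz_H_mul (\pi_(kz_quot x)%qT y) (\pi_(kz_quot x)%qT z) =
  \pi_(kz_quot x)%qT (kz_mul y z).
Proof.
move=> [y0 dy] dz.
have rE u : exists w, repr (\pi_(kz_quot x)%qT u) = u + kz_dif x w.
  have : repr (\pi_(kz_quot x)%qT u) - u \in kz_boundC x.
    by rewrite Quotient.idealrBE reprK.
  by move=> /asboolP[w wE]; exists w; rewrite -wE addrC subrK.
have [[v yE] [w zE]] := (rE y, rE z).
rewrite /kz_H_mul yE zE; apply/eqP; rewrite -Quotient.idealrBE.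
have tyE : ktw idfun y = kscale ((-1) ^+ i) y.
  apply/ffunP => T; rewrite !ffunE /=.
  by have [->//|/y0->] := eqVneq #|T| i; rewrite !mulr0.
have tty : ktw idfun (ktw idfun y) = y.
  by apply/ffunP => T; rewrite !ffunE /= signrMK.
have dty : kz_dif x (ktw idfun y) = 0.
  rewrite tyE; apply/ffunP => T; rewrite !ffunE.
  transitivity ((-1) ^+ i * kz_dif x y T); last by rewrite dy ffunE mulr0.
  rewrite ffunE mulr_sumr; apply: eq_bigr => t _.
  by rewrite ffunE [in RHS]mulrCA [x t * (_ * _)]mulrCA.
(* (y + dv)(z + dw) - yz = y dw + dv (z + dw); the sign twist of y cancels the sign of the Leibniz
   rule in the first term. *)
apply/asboolP; exists (kz_mul (ktw idfun y) w + kz_mul v (z + kz_dif x w)).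
have difD u u' : kz_dif x (u + u') = kz_dif x u + kz_dif x u'.
  exact: (zmorphD (kz_difB x)).
have mul0 (u : K) : kz_mul 0 u = 0 by rewrite kz_mulE kmul0l.
have mul0r' (u : K) : kz_mul u 0 = 0 by rewrite kz_mulE kmul0r.
rewrite difD !kz_dif_mul difD kz_dif_dif dz addr0 mul0r' addr0 dty mul0 add0r tty.
by rewrite kz_mulDl [kz_mul y (_ + _)]kz_mulDr -!addrA [LHS]addrC !addrA subrK.
Qed.

End KoszulProduct.

Section Decomposition.

Variables (k : fieldType) (n : nat).
Local Notation S := {mpoly k[n]}.
Variable I : idealr S.
Hypothesis I_homog : homogeneous_ideal I.
Hypothesis I_nolin : no_linear_forms I.
Local Notation R := {ideal_quot I}.
Variable F : gfree S.
Local Notation JI := [set p : S | p \in (I : pred _)]%classic.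
Hypothesis F_res : is_resolution (@mpoly_gr k n) JI F.
Hypothesis F_min : is_minimal (@mpoly_gr k n) F.
Variable G : dg_algebra (@mpoly_gr k n) JI F.
Local Notation E := (dgtot G).
Variable P : gfree R.
Hypothesis P_res : is_resolution (@quot_gr k n I) (irrelevant (@quot_gr k n I)) P.
Variable i : nat.
Hypothesis i_gt0 : (0 < i)%N.
Local Notation K := {ffun {set 'I_n} -> E}.
Local Notation cardT := (fun T : {set 'I_n} => #|T|).
Implicit Types (f g h : E).

(** The degree j of the left factor may be 0 here; [dec_mx] gives such indices zero rows. *)
Definition dec_index := {j : 'I_i & ('I_(gf_rank F j) * 'I_(gf_rank F (i - j)%N))%type}.
Definition dec_deg (s : dec_index) : nat := tag s.
Definition dec_left (s : dec_index) : E := dgin G (delta_mx 0 (tagged s).1).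
Definition dec_right (s : dec_index) : E := dgin G (delta_mx 0 (tagged s).2).

Definition const_row (q : nat) f : 'rV[k]_(gf_rank F q) := map_mx (mcoeff 0) (f q).

(* The rows span the degree i part of the square of the augmentation ideal of
   k (x) F. *)
Definition dec_mx : 'M[k]_(#|{: dec_index}|, gf_rank F i) :=
  \matrix_(s < #|{: dec_index}|) (if (0 < dec_deg (enum_val s))%N then
    const_row i (dec_left (enum_val s) * dec_right (enum_val s)) else 0).

Lemma dghom_mulE p q l f g : (p + q)%N = l -> dghom p f -> dghom q g ->
  (f * g) l = dgM G l (f p) (g q).
Proof.
move=> <- hf hg; rewrite dgE_M.
have pl : (p < (p + q).+1)%N by rewrite ltnS leq_addr.
have ql : (q < (p + q).+1)%N by rewrite ltnS leq_addl.
rewrite (bigD1 (Ordinal pl)) //= [X in _ + X]big1 ?addr0 => [|a ap]; last first.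
  by rewrite big1 // => b _; rewrite hf ?dgM0l.
rewrite (bigD1 (Ordinal ql)) //= [X in _ + X]big1 ?addr0 // => b bq.
by rewrite hg ?linear0.
Qed.

Lemma dec_mxP p q f g : (0 < p)%N -> (0 < q)%N -> (p + q)%N = i ->
  dghom p f -> dghom q g -> (const_row i (f * g)%R <= dec_mx)%MS.
Proof.
move=> p0 q0 pqi hf hg.
have pi : (p < i)%N by lia.
have qE : q = (i - p)%N by lia.
have e : const_row i (f * g) = \sum_a \sum_b ((f p 0 a)@_0 * (g q 0 b)@_0) *:
    const_row i (dgin G (delta_mx 0 a) * dgin G (delta_mx 0 b)).
  rewrite -pqi; apply/rowP => c; rewrite mxE (dghom_mulE (erefl _) hf hg).
  rewrite {1}(row_sum_delta (f p)) dgM_suml summxE raddf_sum /= summxE.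
  apply: eq_bigr => a _; rewrite {1}(row_sum_delta (g q)) linear_sum summxE raddf_sum /= summxE.
  apply: eq_bigr => b _; rewrite dgMZl linearZ /= scalerA mxE !rmorphM /=.
  rewrite [RHS]mxE; congr (_ * _); rewrite mxE.
  by rewrite (dghom_mulE (erefl _) (dghom_in _ _) (dghom_in _ _)) !dginE.
rewrite e; apply: summx_sub => a _; apply: summx_sub => b _; apply: scalemx_sub.
subst q.
pose s : dec_index := @Tagged _ (Ordinal pi)
  (fun j : 'I_i => ('I_(gf_rank F j) * 'I_(gf_rank F (i - j)%N))%type) (a, b).
have -> : const_row i (dgin G (delta_mx 0 a) * dgin G (delta_mx 0 b)) = row (enum_rank s) dec_mx.
  by rewrite rowK enum_rankK p0.
exact: row_sub.
Qed.

(** A row lies in the row space exactly when every column of [cokermx] kills it, and each column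
    provides a form lam as in [tor_detect]. *)
Lemma tor_dec tau (b : K) : Tor_eq0 (@quot_gr k n I) P i.+1 tau ->
  homX cardT i b -> dgD b = 0 ->
  (forall T : {set 'I_n}, #|T| = i -> quot_gr (tau - i%:Z) (rho (b T))) ->
  (const_row i (b set0) <= dec_mx)%MS.
Proof.
move=> tor hb db gb; rewrite submxE; apply/eqP/rowP => c; rewrite [RHS]mxE.
have [m [m0 hm mD rm]] := pdif_twist F_res G P_res i.
have [kap kapP] := comparison_map I_homog F_res P_res i_gt0 m0 hm mD rm.
have cstB : zmod_morphism (const_row i).
  by move=> f g; apply/rowP => a; rewrite !mxE mcoeffB.
apply: (tor_detect (lam := fun f => (const_row i f *m cokermx dec_mx) 0 c) I_homog I_nolin F_res
  F_min P_res i_gt0 m0 hm mD rm _ _ _ _ kapP tor hb db gb).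
- by move=> f g; rewrite cstB mulmxBl !mxE.
- move=> f mf; have -> : const_row i f = 0 by apply/rowP => a; rewrite !mxE mf.
  by rewrite mul0mx mxE.
- move=> p q f g p0 q0 hf hg; have [pqi|pqi] := eqVneq (p + q)%N i.
    have := dec_mxP p0 q0 pqi hf hg; rewrite submxE => /eqP->.
    by rewrite mxE.
  have -> : const_row i (f * g) = 0; last by rewrite mul0mx mxE.
  apply/rowP => a; rewrite mxE (dghomM hf hg) ?mxE ?raddf0 //.
  by rewrite eq_sym.
move=> a f; have -> : const_row i (dgc G a * f) = a@_0 *: const_row i f.
  by apply/rowP => e; rewrite !mxE dgcl mxE rmorphM.
by rewrite -scalemxAl mxE.
Qed.

End Decomposition.

(** * Descent to the Koszul homology of R *)

Section MainLemmas.

Variables (k : fieldType) (n : nat).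
Local Notation S := {mpoly k[n]}.
Variable I : idealr S.
Hypothesis I_homog : homogeneous_ideal I.
Hypothesis I_nolin : no_linear_forms I.
Local Notation R := {ideal_quot I}.
Variable F : gfree S.
Local Notation JI := [set p : S | p \in (I : pred _)]%classic.
Hypothesis F_res : is_resolution (@mpoly_gr k n) JI F.
Hypothesis F_min : is_minimal (@mpoly_gr k n) F.
Variable G : dg_algebra (@mpoly_gr k n) JI F.
Local Notation E := (dgtot G).
Variable P : gfree R.
Hypothesis P_res : is_resolution (@quot_gr k n I) (irrelevant (@quot_gr k n I)) P.
Variable i : nat.
Hypothesis i_gt0 : (0 < i)%N.
Local Notation K := {ffun {set 'I_n} -> E}.
Local Notation cardT := (fun T : {set 'I_n} => #|T|).
Implicit Types (f g h : E) (b c : K).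

Local Notation dgK := (kmul (@dgs _ _ _ _ G)).
Local Notation q_ := (@qx k n I).

Lemma rho_iter m f : rho (iter m (@dgs _ _ _ _ G) f) = rho f.
Proof. by elim: m => [//|m IHm]; rewrite iterS rho_s. Qed.

Lemma rho_sign m f : rho ((-1) ^+ m * f) = (-1) ^+ m * rho f.
Proof. by rewrite /rho dgE_sign -scalemxAl mxE rmorphMsign. Qed.

Lemma rhoX0 (T : finType) : rhoX (0 : {ffun T -> E}) = 0.
Proof. exact: zmorph0 (@rhoX_additive _ _ _ _ G T). Qed.

Lemma rho_kmul b c : rhoX (dgK b c) = kz_mul (rhoX b) (rhoX c).
Proof.
apply/ffunP => T; rewrite !ffunE (zmorph_sum (@rho_additive _ _ _ _ G)).
apply: eq_bigr => U _; rewrite rho_sign (rho_multiplicative F_res G).2 !ffunE; congr (_ * (_ * _)).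
exact: rho_iter.
Qed.

Lemma dghom_iter m q f : dghom q f -> dghom q (iter m (@dgs _ _ _ _ G) f).
Proof. by move=> hf; elim: m => //= m; apply: dghom_s. Qed.

Lemma homX_kmul p q b c : homX cardT p b -> homX cardT q c ->
  homX cardT (p + q)%N (dgK b c).
Proof.
move=> hb hc T r rT; rewrite ffunE dgE_sum big1 // => U UT; rewrite dgE_sign.
have TU : (#|T| = #|U| + #|T :\: U|)%N by rewrite -(cardsID U T) (setIidPr UT).
have [Up|pU] := leqP #|U| p; last by rewrite (homX_gt hb) // mul0r scaler0.
have [Vq|qV] := leqP #|T :\: U| q; last first.
  by rewrite (homX_gt hc) // raddf0 mulr0 scaler0.
rewrite (dghomM (homX_dghom hb Up) (dghom_iter _ (homX_dghom hc Vq))) ?scaler0 //.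
by apply: contraNneq rT => ->; rewrite TU; apply/eqP; lia.
Qed.

Lemma dgD_kmul b c : dgD b = 0 -> dgD c = 0 -> dgD (dgK b c) = 0.
Proof.
move=> db dc; rewrite /dgD kd_kmul; first last.
- exact: dgdM.
- exact: dgds.
- exact: dgss.
- exact: kx_s.
- exact: kxC.
by rewrite -/(dgD b) -/(dgD c) db dc kmul0l kmul0r addr0.
Qed.

Lemma kz_cycle_rho q b : homX cardT q b -> dgD b = 0 -> kz_cycle q_ q (rhoX b).
Proof.
move=> hb db; split; first by move=> T Tq; apply: homX_supp hb Tq.
have /= <- := sf_rho (dgD_semifree F_res G) b.
by change (rhoX (dgD b) = 0); rewrite db rhoX0.
Qed.

(** Lift z to a cycle b over F. Modulo the maximal ideal its coefficient at e_set0 is a sum of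
    products; lift their factors to cycles. Then b minus the sum of products of these lifts is a
    cycle with e_set0 coefficient in the maximal ideal, hence a boundary, and reduction to R
    concludes. *)
Theorem homology_decomposable tau : Tor_eq0 (@quot_gr k n I) P i.+1 tau ->
  (@kz_H_deg _ (@quot_gr k n I) n q_ i tau `<=`
   @kz_H_decomp_deg _ (@quot_gr k n I) n q_ i tau)%classic.
Proof.
move=> tor h zh; split=> //; case: zh => z [[z0 dz] gz] <-.
have [|b [hb db rb]] := sf_cycle_lift F_res (dgD_semifree F_res G) z0.
  exact: dz.
have zE T : z T = rho (b T) by rewrite -rb ffunE.
have gb (T : {set 'I_n}) : #|T| = i -> quot_gr (tau - i%:Z) (rho (b T)).
  by rewrite -zE; apply: gz.
have /submxP[u uE] := tor_dec I_homog I_nolin F_res F_min P_res i_gt0 tor hb db gb.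
pose N := #|{: dec_index F i}|.
have ex (r : 'I_N) : exists p : K * K, let s := enum_val r in
    [/\ homX cardT (dec_deg s) p.1 /\ homX cardT (i - dec_deg s)%N p.2,
        dgD p.1 = 0, dgD p.2 = 0, p.1 set0 = (dgc G (u 0 r)%:MP : E) * dec_left G s &
        p.2 set0 = dec_right G s].
  set s := enum_val r.
  have hl : dghom (dec_deg s) ((dgc G (u 0 r)%:MP : E) * dec_left G s).
    by apply: (dghomM (p := 0)) (dghom_c _ _) (dghom_in _ _).
  have hr : dghom (i - dec_deg s)%N (dec_right G s) by apply: dghom_in.
  have [b1 [h1 d1 e1]] := dg_cycle_lift F_res F_min hl.
  have [b2 [h2 d2 e2]] := dg_cycle_lift F_res F_min hr.
  exists (b1, b2); split; [split; [exact: h1 | exact: h2] | exact: d1 | exact: d2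
    | exact: e1 | exact: e2].
have dgDB : zmod_morphism (@dgD _ _ _ _ G) := (dgD_leibniz G).1.
have [p pP] := boolp.choice ex.
pose ok (r : 'I_N) := (0 < dec_deg (enum_val r))%N.
pose y := \sum_(r | ok r) dgK (p r).1 (p r).2.
have degi (s : dec_index F i) : (dec_deg s < i)%N by apply: ltn_ord.
have hy : homX cardT i y.
  apply: homX_sum => r _; have [[h1 h2] _ _ _ _] := pP r.
  have -> : i = (dec_deg (enum_val r) + (i - dec_deg (enum_val r)))%N.
    by rewrite subnKC // ltnW.
  exact: homX_kmul.
have dy : dgD y = 0.
  rewrite /y (zmorph_sum dgDB); apply: big1 => r _.
  by have [_ d1 d2 _ _] := pP r; apply: dgD_kmul.
have y0 : y set0 = \sum_(r | ok r)
    dgc G (u 0 r)%:MP * (dec_left G (enum_val r) * dec_right G (enum_val r)).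
  rewrite sum_ffunE; apply: eq_bigr => r _; have [_ _ _ e1 e2] := pP r.
  rewrite ffunE (bigD1 set0) ?sub0set //= big1 ?addr0 => [|U /andP[U0 nU]]; last first.
    by rewrite subset0 (negPf nU) in U0.
  rewrite cards0 /= setD0 e1 e2 (_ : kz_inv set0 set0 = 0%N) ?mul1r ?mulrA //.
  by rewrite kz_invE big_set0.
have my : dgmax ((b - y) set0).
  move=> q; have [->|qi] := eqVneq q i => a; last first.
    by rewrite (homXB hb hy) ?cards0 ?addn0 // mxE raddf0.
  move/rowP/(_ a): uE.
  rewrite !mxE [(b - y) set0]ffunE [(- y) set0]ffunE dgE_D dgE_N !mxE mcoeffB => ->.
  rewrite y0 dgE_sum summxE raddf_sum [X in _ - X]big_mkcond -sumrB big1 //= => r _.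
  rewrite mxE /ok; case: ifP => _; last by rewrite mxE mulr0 subr0.
  by rewrite dgcl !mxE mcoeffCM subrr.
have [|w [_ dw _]] := dgD_exact F_res (homXB hb hy) _ my.
  by rewrite dgDB db dy subrr.
exists [seq (\pi_(kz_quot q_)%qT (rhoX (p r).1), \pi_(kz_quot q_)%qT (rhoX (p r).2)) |
         r <- enum 'I_N & ok r].
  move=> pr /mapP[r + ->]; rewrite mem_filter => /andP[rok _].
  have [[h1 h2] d1 d2 _ _] := pP r; have di := degi (enum_val r).
  (* In [kz_H_decomp] the index j is the degree of the right factor. *)
  exists (i - dec_deg (enum_val r))%N; first by rewrite /ok in rok; lia.
  split; last by exists (rhoX (p r).2) => //; apply: kz_cycle_rho.
  by rewrite subKn ?(ltnW di) //; exists (rhoX (p r).1) => //; apply: kz_cycle_rho.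
rewrite big_map big_filter big_enum_cond /=.
have -> : z = \sum_(r | ok r) kz_mul (rhoX (p r).1) (rhoX (p r).2) + kz_dif q_ (rhoX w).
  have /= <- := sf_rho (dgD_semifree F_res G) w.
  change (z = \sum_(r | ok r) kz_mul (rhoX (p r).1) (rhoX (p r).2) + rhoX (dgD w)).
  rewrite dw (rhoX_additive b y) rb (zmorph_sum (@rhoX_additive _ _ _ _ G _)).
  by under eq_bigr do rewrite -rho_kmul; rewrite addrC subrK.
have -> : \pi_(kz_quot q_)%qT (\sum_(r | ok r) kz_mul (rhoX (p r).1) (rhoX (p r).2) +
    kz_dif q_ (rhoX w)) =
  \pi_(kz_quot q_)%qT (\sum_(r | ok r) kz_mul (rhoX (p r).1) (rhoX (p r).2)).
  apply/eqP; rewrite -Quotient.idealrBE addrC addKr.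
  by apply/asboolP; exists (rhoX w).
rewrite raddf_sum; apply: eq_bigr => r _; have [[h1 h2] d1 d2 _ _] := pP r.
by rewrite (kz_H_mul_pi (kz_cycle_rho h1 d1)) //; case: (kz_cycle_rho h2 d2).
Qed.

(** * Internal degrees over F and the degrees of the generators *)

Definition dgpr (t : int) f : E :=
  fun q => \row_c mpr (t - @gf_deg _ F q c) (f q 0 c).

Let mP := mpr_proj k n.

Lemma mpr0 j : mpr j 0 = 0 :> S.
Proof. exact: (zmorph0 (gpr_additive mP j)). Qed.

Lemma dgpr_additive t : zmod_morphism (dgpr t).
Proof.
move=> f g; apply: dgP => q; apply/rowP => c.
by rewrite !mxE (gpr_additive mP).
Qed.

Lemma dgpr_d t f : dgd (dgpr t f) = dgpr t (dgd f).
Proof.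
apply: dgP => q; rewrite /dgd /dgpr.
by rewrite (pr_mulmx mP (ds := @gf_deg _ F q)) // => a b; apply: (res_dif_homog F_res).
Qed.

Lemma mpr_sign j m p : mpr j ((-1) ^+ m * p) = (-1) ^+ m * mpr j p :> S.
Proof.
rewrite -signr_odd !mulr_sign; case: (odd m) => //.
exact: (zmorphN (gpr_additive mP j)).
Qed.

Lemma dgpr_kterm t m a f q : dgpr (t + 1) ((-1) ^+ m * (kx G a * dgs f)) q =
  (((-1) ^+ m : E) * (kx G a * dgs (dgpr t f))) q.
Proof.
apply: etrans _ (esym (dgE_kterm m a (dgpr t f) q)); apply/rowP => c.
rewrite [LHS]mxE; apply: (etrans (congr1 (fun w : 'rV_(gf_rank F q) =>
  mpr (t + 1 - gf_deg c) (w 0 c)) (dgE_kterm m a f q))).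
rewrite 3![in LHS]mxE 4![in RHS]mxE.
rewrite mpr_sign.
congr (_ * _).
rewrite -addrA [1 + _]addrC addrA.
rewrite mulrC.
rewrite (gpr_mul mP).
rewrite mpr_sign.
exact: mulrC.
by rewrite /= dhomogX /= mdeg1.
Qed.

(** The shift reflects that e_T has internal degree |T|, which makes the projection commute with
    [dgD]: lifted cycles can be made homogeneous. *)
Definition kpr (t : int) b : K := [ffun T : {set 'I_n} => dgpr (t - #|T|%:Z) (b T)].

Lemma dgD_kpr t b : dgD (kpr t b) = kpr t (dgD b).
Proof.
apply/ffunP => T; apply: etrans (dgDE _ _) _; rewrite [RHS]ffunE.
apply: etrans _ (congr1 (dgpr _) (esym (dgDE b T))).
rewrite [RHS](zmorphD (dgpr_additive _)); congr (_ + _).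
  by rewrite ffunE dgpr_d.
apply: etrans (kosDE _ _) _; apply: etrans _ (congr1 (dgpr _) (esym (kosDE b T))).
rewrite [RHS](zmorph_sum (dgpr_additive _)); apply: eq_bigr => a aT.
apply: dgP => q; have -> : (t - #|T|%:Z = t - #|a |: T|%:Z + 1)%R.
  by rewrite cardsU1 aT PoszD opprD addrA addrAC subrK.
by apply: etrans _ (esym (dgpr_kterm _ _ _ _ _)); rewrite ffunE.
Qed.

Lemma homX_kpr q t b : homX cardT q b -> homX cardT q (kpr t b).
Proof.
move=> hb T r rT; rewrite ffunE; apply/rowP => c.
by rewrite !mxE hb // mxE mpr0.
Qed.

Lemma rho_dgpr t f : quot_gr t (rho (dgpr t f)).
Proof.
exists (((dgpr t f) 0 *m gf_aug F) 0 0) => //; rewrite mxE.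
apply: (gr_sum mP) => c _; rewrite mxE -[t in mpoly_gr t](subrK (gf_deg c)).
by apply: (grM mP); [exact: gpr_gr mP _ _ | exact: res_aug_homog F_res _].
Qed.

(** An element v of degree tau is the e_set0 coefficient of a homogeneous cycle, so its constant
    part is a combination of products of generators; these have degree below tau. *)
Lemma tor_eq0_of_degrees tau : Tor_eq0 (@quot_gr k n I) P i.+1 tau ->
  (forall j, (0 < j < i)%N -> forall (a : 'I_(gf_rank F j)) (c : 'I_(gf_rank F (i - j)%N)),
     gf_deg a + gf_deg c < tau) ->
  Tor_eq0 (@mpoly_gr k n) F i tau.
Proof.
(* By minimality boundaries are 0 in k (x) F, so v itself must have all coefficients in the maximal
   ideal. *)
move=> tor dlt v vc; exists 0 => c; rewrite mul0mx subr0.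
have hv : gf_homog (@mpoly_gr k n) tau v.
  by case: (i) v vc i_gt0 {c} => // i' v [].
have [b [hb db b0]] := dg_cycle_lift F_res F_min (dghom_in G v).
have hb' := homX_kpr tau hb.
have db' : dgD (kpr tau b) = 0.
  rewrite dgD_kpr db; apply/ffunP => T; rewrite !ffunE.
  exact: (zmorph0 (dgpr_additive _)).
have gb (T : {set 'I_n}) : #|T| = i -> quot_gr (tau - i%:Z) (rho (kpr tau b T)).
  by move=> <-; rewrite ffunE; apply: rho_dgpr.
have /submxP[u uE] := tor_dec I_homog I_nolin F_res F_min P_res i_gt0 tor hb' db' gb.
have {uE} : (v 0 c)@_0 = \sum_r u 0 r * dec_mx G i r c.
  move/rowP/(_ c): uE; rewrite !mxE ffunE b0 cards0 subr0 mxE dginE.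
  by rewrite (gpr_id mP (hv c)).
have [vc0 _|vc0] := eqVneq (v 0 c)@_0 0; first exact/irrelevant_mpoly.
have tc : tau = gf_deg c.
  move: (hv c); case e : (tau - gf_deg c) => [d|d] /= vd; last first.
    by rewrite vd mcoeff0 eqxx in vc0.
  have d0 : d = 0%N.
    by apply/eqP; apply: contraNT vc0 => d0; rewrite (dhomog_nemf_coeff vd) //= mdeg0 eq_sym.
  by apply/eqP; rewrite -subr_eq0 e d0.
rewrite big1 => [v0|r _]; first by rewrite v0 eqxx in vc0.
rewrite mxE; set s := enum_val r; case: ifP => s0; rewrite mxE ?mulr0 //.
have si : (dec_deg s < i)%N by apply: ltn_ord.
have e : (dec_deg s + (i - dec_deg s) = i)%N by rewrite subnKC // ltnW.
have hdelta q (a : 'I_(gf_rank F q)) : gf_homog (@mpoly_gr k n) (gf_deg a) (delta_mx 0 a).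
  move=> a'; rewrite mxE /=; have [->|ne] := eqVneq a' a; last exact: (gr0 mP).
  by rewrite subrr /= dhomog1.
have := dg_homog G e (hdelta _ (tagged s).1) (hdelta _ (tagged s).2) c.
have lt := dlt (dec_deg s) (introT andP (conj s0 si)) (tagged s).1 (tagged s).2.
rewrite -(dgME G e) tc in lt *.
(* The entry at c of the product has degree strictly below that of c, so it lies in a negative
   degree of S, which is 0. *)
case E1 : (_ - _) => [d|d].
  by move: lt; rewrite -subr_lt0 E1.
move=> pE; suff -> : (dec_left G s * dec_right G s) i 0 c = 0.
  by rewrite mcoeff0 mulr0.
rewrite -pE (dghom_mulE e (dghom_in _ _) (dghom_in _ _)).
by rewrite /dec_left /dec_right !dginE.
Qed.

End MainLemmas.

(** * Bounds in the extended integers *)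

Lemma int_set_max (A : set int) (N : int) : (exists j, A j) ->
  (forall j, A j -> j <= N) -> exists2 j, A j & forall l, A l -> l <= j.
Proof.
move=> [j Aj] AN; pose Q m := `[< A (N - m%:Z) >].
have exQ : exists m, Q m.
  exists `|N - j|%N; apply/asboolP; rewrite gez0_abs ?subr_ge0 ?AN //.
  by rewrite opprB addrC subrK.
have [m /asboolP Am mmin] := ex_minnP exQ; exists (N - m%:Z) => // l Al.
have lN := AN l Al; have Ql : Q `|N - l|%N.
  by apply/asboolP; rewrite gez0_abs ?subr_ge0 // opprB addrC subrK.
have := mmin _ Ql; lia.
Qed.

Lemma int_set_min (A : set int) (N : int) : (exists j, A j) ->
  (forall j, A j -> N <= j) -> exists2 j, A j & forall l, A l -> j <= l.
Proof.
move=> [j Aj] AN.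
have [||l /= Al lmin] := @int_set_max [set j | A (- j)]%classic (- N).
- by exists (- j); rewrite /= opprK.
- by move=> l /= /AN; rewrite lerNr.
by exists (- l) => // m Am; rewrite lerNl lmin //= opprK.
Qed.

Section ExtendedIntBounds.

Variable A : set int.
Local Notation EA := [set j%:E | j in A]%classic.

(** [supremum] returns its default when there is no least upper bound, so one is exhibited: the
    maximum if A is bounded above, +oo otherwise. *)
Lemma eint_sup_ge (j : int) : A j -> (j%:E <= supremum -oo EA)%E.
Proof.
move=> Aj; apply: ge_supremum_Nmem; last by exists j.
have [[N AN]|nb] := pselect (exists N, forall l, A l -> l <= N).
  have [m Am mmax] := int_set_max (ex_intro _ j Aj) AN.
  exists m%:E; split=> [_ [l Al <-]|u]; first by rewrite lee_fin mmax.
  by apply; exists m.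
exists +oo%E; split=> [x _|u uA]; first exact: leey.
case: u uA => [N uA| |uA]; [|by []|].
  case: nb; exists N => l Al; rewrite -lee_fin; apply: uA; by exists l.
by have := uA j%:E (ex_intro2 _ _ j Aj erefl).
Qed.

Lemma eint_sup_le c : (forall j, A j -> (j%:E <= c)%E) -> (supremum -oo EA <= c)%E.
Proof.
move=> Ac; rewrite /supremum; case: ifPn => [_|/set0P[_ [j Aj _]]]; first exact: leNye.
case: xgetP => [y _ [_ ymin]|_]; last exact: leNye.
by apply: ymin => _ [l Al <-]; apply: Ac.
Qed.

Lemma eint_inf_le (j : int) : A j -> (infimum +oo EA <= j%:E)%E.
Proof.
move=> Aj; apply: le_infimum_Nmem; last by exists j.
have [[N AN]|nb] := pselect (exists N, forall l, A l -> N <= l).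
  have [m Am mmin] := int_set_min (ex_intro _ j Aj) AN.
  exists m%:E; split=> [_ [l Al <-]|u]; first by rewrite lee_fin mmin.
  by apply; exists m.
exists -oo%E; split=> [x _|u uA]; first exact: leNye.
case: u uA => [N uA|uA|]; [| |by []].
  case: nb; exists N => l Al; rewrite -lee_fin; apply: uA; by exists l.
by have := uA j%:E (ex_intro2 _ _ j Aj erefl).
Qed.

End ExtendedIntBounds.

(** By minimality a basis vector is a cycle of k (x) F, and it is no boundary since boundaries have
    no unit coefficient. *)
Lemma minimal_Tor_degree (k : fieldType) (n : nat) (F : gfree {mpoly k[n]})
    (F_min : is_minimal (@mpoly_gr k n) F) j (a : 'I_(gf_rank F j)) :
  ((gf_deg a)%:E <= Tor_sup (@mpoly_gr k n) F j)%E.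
Proof.
apply: eint_sup_ge => tor.
have ha : gf_homog (@mpoly_gr k n) (gf_deg a) (delta_mx 0 a).
  move=> c; rewrite mxE /=; have [->|ne] := eqVneq c a; last exact: (gr0 (mpr_proj k n)).
  by rewrite subrr /= dhomog1.
have [|w /(_ a) /irrelevant_mpoly] := tor (delta_mx 0 a).
  case: j a {tor} ha => [|j] a ha //; split=> // c.
  by rewrite -rowE mxE; apply: F_min.
rewrite !mxE !eqxx mcoeffB mcoeff1 eqxx raddf_sum big1 /= => [|c _].
  by rewrite subr0 => /eqP; rewrite oner_eq0.
by have /irrelevant_mpoly d0 := F_min j c a; rewrite rmorphM /= d0 mulr0.
Qed.

Import boolp classical_sets constructive_ereal.
Local Open Scope classical_set_scope.

Unset Implicit Arguments.

Theorem theorem2p9 (k : fieldType) (n : nat) (I : idealr {mpoly k[n]})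
  (I_homog : homogeneous_ideal I)
  (I_nolin : no_linear_forms I)
  (* F: the graded minimal free resolution of R = S/I over S *)
  (F : gfree {mpoly k[n]})
  (F_res : is_resolution (@mpoly_gr k n) [set p | p \in (I : pred _)] F)
  (F_min : is_minimal (@mpoly_gr k n) F)
  (F_dg : inhabited
            (dg_algebra (@mpoly_gr k n) [set p | p \in (I : pred _)] F))
  (* P: a graded free resolution of k = R/R_+ over R *)
  (P : gfree {ideal_quot I})
  (P_res : is_resolution (@quot_gr k n I) (irrelevant (@quot_gr k n I)) P)
  (i : nat) (i_ge2 : (2 <= i)%N) :
  let x (a : 'I_n) : {ideal_quot I} := \pi_({ideal_quot I})%qT 'X_a in
  let H := @kz_H_deg _ (@quot_gr k n I) n x in
  let D := @kz_H_decomp_deg _ (@quot_gr k n I) n x in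
  let tS := Tor_sup (@mpoly_gr k n) F in
  let tR := Tor_sup (@quot_gr k n I) P in
  let sR := Tor_inf (@quot_gr k n I) P in
  [/\ forall tau : int,
        Tor_eq0 (@quot_gr k n I) P i.+1 tau -> H i tau `<=` D i tau,
      forall tau : int,
        (tR i.+1 < tau%:E)%E \/ (tau%:E < sR i.+1)%E -> H i tau `<=` D i tau &
      (2%:Z%:E <= height I)%E -> (tR i.+1 < tS i)%E ->
        (tS i <= \big[maxe/-oo]_(1 <= j < i) (tS j + tS (i - j)%N))%E].
Proof.
move=> x H D tS tR sR; have i_gt0 : (0 < i)%N by apply: leq_trans i_ge2.
case: F_dg => G.
have part1 tau : Tor_eq0 (@quot_gr k n I) P i.+1 tau -> H i tau `<=` D i tau.
  exact: (homology_decomposable I_homog I_nolin F_res F_min G P_res i_gt0).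
have sR_le tau : ~ Tor_eq0 (@quot_gr k n I) P i.+1 tau ->
    (sR i.+1 <= tau%:E)%E /\ (tau%:E <= tR i.+1)%E.
  by move=> tor; split; [exact: eint_inf_le | exact: eint_sup_ge].
split=> // [tau lt|_ tRS].
  apply: part1; apply: contrapT => /sR_le[sRt ttR].
  by case: lt; rewrite ltNge ?sRt ?ttR.
rewrite leNgt; apply/negP => MtS.
set M := \big[_/_]_(_ <= _ < _) _ in MtS.
(* Both M and tR are below tS, so it is enough to bound every nonvanishing degree of Tor_i by their
   maximum; no degree attaining the supremum has to be chosen. *)
have : ~ (tS i <= maxe M (tR i.+1))%E.
  by apply/negP; rewrite -ltNge gt_max MtS.
apply; apply: eint_sup_le => tau tor; rewrite leNgt; apply/negP.
rewrite gt_max => /andP[Mt tRt]; apply: tor.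
apply: (tor_eq0_of_degrees I_homog I_nolin F_res F_min G P_res i_gt0).
  apply: contrapT => /sR_le[_]; by rewrite leNgt tRt.
move=> j /andP[j0 ji] a c; rewrite -lte_fin EFinD.
apply: le_lt_trans Mt; apply: le_trans (_ : tS j + tS (i - j)%N <= M)%E.
  by apply: leeD; apply: minimal_Tor_degree.
apply: (@le_bigmax_seq _ _ _ _ _ j xpredT (fun j => tS j + tS (i - j)%N)%E) => //.
by rewrite mem_index_iota j0.
Qed.
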